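(* Let $n\ge 1$ be an integer and let $k,a,m\in\mathbb{C}$ with $a\neq 0$ and $\operatorname{Im}(m)\ge 0$, such that all terms occurring below are defined. Then $$\sum_{p=0}^{n-1}3^{-p}\Big(\log^k(a)+2^k\left(i3^{p+1}\right)^k e^{2im3^p}\Big(-3\,\Phi\big(-e^{2i3^{p+1}m},-k,\tfrac16(2-i3^{-p}\log(a))\big)+3e^{2im3^p}\,\Phi\big(-e^{2i3^{p+1}m},-k,\tfrac16(4-i3^{-p}\log(a))\big)-2e^{4im3^p}\,\Phi\big(-e^{2i3^{p+1}m},-k,\tfrac16(6-i3^{-p}\log(a))\big)\Big)\Big)$$ $$=\frac12\,3^{1-n}\Big(\left(3^n-1\right)\log^k(a)+2^{k+1}\Big(\left(i3^n\right)^k e^{2im3^n}\,\Phi\big(-e^{2i3^nm},-k,1-\tfrac12 i3^{-n}\log(a)\big)-i^k e^{2im}3^n\,\Phi\big(-e^{2im},-k,1-\tfrac12 i\log(a)\big)\Big)\Big).$$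
   Context: $\Phi(z,s,v)$ is the Hurwitz-Lerch zeta function: for $v\in\mathbb{C}\setminus\{0,-1,-2,\dots\}$, $\Phi(z,s,v)=\sum_{j=0}^{\infty}(v+j)^{-s}z^{j}$, convergent for $|z|<1$ and all $s\in\mathbb{C}$, and also for $|z|=1$ when $\operatorname{Re}(s)>1$; for $|z|=1$ and other $s$ it is defined by analytic continuation in $s$ (for $z=1$ this is the Hurwitz zeta function, with $s=1$ excluded). For $\operatorname{Re}(v)>0$ it has the integral representation $\Phi(z,s,v)=\frac{1}{\Gamma(s)}\int_0^\infty\frac{t^{s-1}e^{-(v-1)t}}{e^t-z}\,dt$ when either $|z|\le 1$, $z\ne1$, $\operatorname{Re}(s)>0$, or $z=1$, $\operatorname{Re}(s)>1$. Here $i=\sqrt{-1}$, $\log$ is the principal logarithm, $\log^k(a)=(\log a)^k$, and all complex powers are principal values. ''All terms defined'' means that the third argument of each $\Phi$ is not in $\{0,-1,-2,\dots\}$, that the case (first argument of $\Phi$ equal to $1$ and $k=-1$) does not occur, and that the power $(\log a)^k$ is defined. *)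

(* Defs.v *)
From Stdlib Require Import Reals.
From Coquelicot Require Import Coquelicot.

Local Open Scope C_scope.

Definition Cexp (z : C) : C :=
  ((exp (Re z) * cos (Im z))%R, (exp (Re z) * sin (Im z))%R).

(* Principal argument, with values in (-PI, PI]; on the negative real axis it
   is [acos (-1) = PI]. *)
Definition Carg (z : C) : R :=
  if Rle_dec 0 (Im z) then acos (Re z / Cmod z) else (- acos (Re z / Cmod z))%R.

Definition Clog (z : C) : C := (ln (Cmod z), Carg z).

(* Principal complex power.  For base 0 it is meaningful only when the exponent
   has positive real part (value 0) or is 0 (value 1); see [Cpower_defined]. *)
Definition Cpower (z w : C) : C :=
  if Ceq_dec z 0 then (if Ceq_dec w 0 then 1 else 0) else Cexp (w * Clog z).

Definition Cpower_defined (z w : C) : Prop :=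
  z <> 0 \/ (0 < Re w)%R \/ w = 0.

(* Local expandability in a convergent power series at every point of [D]. *)
Definition analytic_on (D : C -> Prop) (f : C -> C) : Prop :=
  forall s0 : C, D s0 ->
    exists (r : R) (c : nat -> C), (0 < r)%R /\
      forall s : C, (Cmod (s - s0) < r)%R ->
        is_pseries (K := C_AbsRing) (V := C_NormedModule) c (s - s0) (f s).

Definition lerch_term (z s v : C) (j : nat) : C :=
  Cpower (v + INR j) (- s) * z ^ j.

Definition is_lerch_series (z s v w : C) : Prop :=
  is_series (K := C_AbsRing) (V := C_NormedModule) (lerch_term z s v) w.

(* The domain in [s] of the continued function when |z| = 1: the whole plane,
   punctured at [s = 1] for the Hurwitz zeta function [z = 1].  In both cases it
   is open and connected and contains the half-plane Re s > 1. *)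
Definition lerch_domain (z s : C) : Prop := ~ (z = 1 /\ s = 1).

Definition is_lerch_continuation (z v : C) (F : C -> C) : Prop :=
  analytic_on (lerch_domain z) F /\
  forall s : C, (1 < Re s)%R -> is_lerch_series z s v (F s).

Definition is_hurwitz_lerch (z s v w : C) : Prop :=
  (Cmod z < 1)%R /\ is_lerch_series z s v w \/
  Cmod z = 1%R /\ lerch_domain z s /\
    exists F : C -> C, is_lerch_continuation z v F /\ F s = w.

(* [iota] is definite description: the value is the unique [w] satisfying
   [is_hurwitz_lerch z s v w], and is unspecified if there is no such [w]. *)
Definition hurwitz_lerch (z s v : C) : C :=
  iota (T := C_CompleteNormedModule) (is_hurwitz_lerch z s v).

Definition hurwitz_lerch_defined (z s v : C) : Prop :=
  (forall j : nat, v <> - INR j) /\ lerch_domain z s.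

(* Main.v *)
Require Import Defs.
From Stdlib Require Import Reals Lra Lia Factorial IndefiniteDescription.
From Coquelicot Require Import Coquelicot.

(** Put [L = Clog a], [z_p = - Cexp (2 i 3^p m)] and [v_p = 1 - i 3^(-p) L / 2].
    Then [z_(p+1) = z_p ^ 3], [Cexp (2 i m 3^p) = - z_p], and the three third
    arguments of the [p]-th summand are [v_p / 3], [(v_p + 1) / 3] and
    [(v_p + 2) / 3 = v_(p+1)].  Sorting the terms of a Lerch series by the
    residue of their index modulo 3 gives the triplication formula
      [Phi (z, s, v) = 3^(-s) (Phi (z^3, s, v/3) + z Phi (z^3, s, (v+1)/3)
                                + z^2 Phi (z^3, s, (v+2)/3))]
    ([hurwitz_lerch_triplication]).  It trades the first two values of [Phi] in
    the [p]-th summand for one value at [z_p], and with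
    [h p = (i 3^p)^k Cexp (2 i m 3^p) Phi (z_p, -k, v_p)] the summand becomes
      [3^(-p) L^k - 3^(1-p) 2^k h p + 3^(-p) 2^k h (p+1)],
    which telescopes ([telescoping_sum]).

    On [|z| = 1] the value of [Phi] is picked out by a description, so the
    triplication formula there rests on the existence and the uniqueness of the
    analytic continuation in [s].

    Uniqueness is the identity theorem, propagated along segments
    ([vanishes_along_segment]); it also carries the triplication formula from
    [Re s > 1], where it is an identity of series, to the whole domain.

    Existence ([ex_lerch_continuation]): shifting [v] by an integer changes the
    series by finitely many entire terms, so [Re v >= 2] may be assumed.
    Expanding [(u+1)^w] in the binomial series [sum_l C(w,l) u^(w-l)] at each
    [u = v + j] and summing over [j] gives, for [Re w < 0],
      [sum_j z^j ((v+j+1)^w - (v+j)^w) = sum_(l >= 1) C(w,l) Phi (z, l-w, v)]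
    ([lerch_difference_expansion]).  With [w = -s] and [z <> 1] the left side is
    a combination of [Phi (z, s, v)] and [v^(-s)]; with [w = 1-s] and [z = 1] it
    is [- v^(1-s)] and the term [l = 1] on the right is [(1-s) Phi (1, s, v)].
    So [Phi], respectively [(s-1) Phi], satisfies an equation
      [G s = b s + sum_(l >= 1) q_l s * G (s + l)]
    with entire [b] and [q_l], which defines [G] on [Re s > -N] once it is known
    on [Re s > 1-N] ([continuation_step], [entire_continuation]).

    Analyticity is handled through the algebra of power series that converge
    absolutely on a closed disc ([wiener]): its norm is submultiplicative and
    bounds sums, products and infinite series of functions, so a family of
    analytic functions is estimated like a family of numbers, and a sum of
    analytic functions with summable norms is analytic. *)

Local Open Scope C_scope.

Local Notation is_Cseries := (@is_series C_AbsRing C_NormedModule).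
Local Notation Csum_n := (@sum_n C_AbelianMonoid).

(** * Series of complex numbers *)

Definition Ctends (u : nat -> C) (l : C) : Prop :=
  forall eps : R, (0 < eps)%R ->
    exists N, forall n, (N <= n)%nat -> (Cmod (u n - l) < eps)%R.

Lemma sum_n_S_R (a : nat -> R) n : sum_n a (S n) = (sum_n a n + a (S n))%R.
Proof. exact (sum_Sn a n). Qed.

Lemma sum_n_S_C (a : nat -> C) n : Csum_n a (S n) = Csum_n a n + a (S n).
Proof. exact (sum_Sn (G := C_AbelianMonoid) a n). Qed.

Lemma is_Cseries_tends (a : nat -> C) (l : C) :
  is_Cseries a l <-> Ctends (Csum_n a) l.
Proof.
  unfold is_series.
  rewrite (filterlim_locally_ball_norm (K := C_AbsRing) (U := C_NormedModule)).
  split.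
  - intros H eps He. destruct (H (mkposreal eps He)) as [N HN].
    exists N. intros n Hn. exact (HN n Hn).
  - intros H eps. destruct (H eps (cond_pos eps)) as [N HN].
    exists N. intros n Hn. exact (HN n Hn).
Qed.

Lemma Ctends_unique u l l' : Ctends u l -> Ctends u l' -> l = l'.
Proof.
  intros H H'.
  destruct (Ceq_dec l l') as [|Hne]; [assumption|exfalso].
  assert (Hd : (0 < Cmod (l - l'))%R).
  { apply Cmod_gt_0. intro E. apply Hne. replace l with (l - l' + l') by ring.
    rewrite E. ring. }
  destruct (H (Cmod (l - l') / 2)%R) as [N HN]; [lra|].
  destruct (H' (Cmod (l - l') / 2)%R) as [N' HN']; [lra|].
  specialize (HN (N + N')%nat ltac:(lia)).
  specialize (HN' (N + N')%nat ltac:(lia)).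
  assert (Ht := Cmod_triangle (- (u (N + N')%nat - l)) (u (N + N')%nat - l')).
  rewrite Cmod_opp in Ht.
  replace (- (u (N + N')%nat - l) + (u (N + N')%nat - l')) with (l - l') in Ht by ring.
  lra.
Qed.

Lemma is_Cseries_unique (a : nat -> C) (l l' : C) : is_Cseries a l -> is_Cseries a l' -> l = l'.
Proof. rewrite !is_Cseries_tends. apply Ctends_unique. Qed.

Lemma Ctends_ext u w l : (forall n, u n = w n) -> Ctends u l -> Ctends w l.
Proof.
  intros E H eps He. destruct (H eps He) as [N HN]. exists N. intros n Hn.
  rewrite <- E. auto.
Qed.

Lemma Ctends_plus u w l m :
  Ctends u l -> Ctends w m -> Ctends (fun n => u n + w n) (l + m).
Proof.
  intros H H' eps He.
  destruct (H (eps / 2)%R) as [N HN]; [lra|].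
  destruct (H' (eps / 2)%R) as [N' HN']; [lra|].
  exists (N + N')%nat. intros n Hn.
  specialize (HN n ltac:(lia)). specialize (HN' n ltac:(lia)).
  replace (u n + w n - (l + m)) with ((u n - l) + (w n - m)) by ring.
  apply Rle_lt_trans with (1 := Cmod_triangle _ _). lra.
Qed.

Lemma Ctends_norm_le u l M :
  (exists N, forall n, (N <= n)%nat -> (Cmod (u n) <= M)%R) -> Ctends u l ->
  (Cmod l <= M)%R.
Proof.
  intros [N HN] H. apply Rnot_lt_le. intro Hlt.
  destruct (H (Cmod l - M)%R) as [N' HN']; [lra|].
  specialize (HN (N + N')%nat ltac:(lia)). specialize (HN' (N + N')%nat ltac:(lia)).
  assert (Ht := Cmod_triangle (- (u (N + N')%nat - l)) (u (N + N')%nat)).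
  rewrite Cmod_opp in Ht.
  replace (- (u (N + N')%nat - l) + u (N + N')%nat) with l in Ht by ring. lra.
Qed.

Lemma is_Cseries_ext (a b : nat -> C) (l : C) :
  (forall n, a n = b n) -> is_Cseries a l -> is_Cseries b l.
Proof. apply is_series_ext. Qed.

Lemma is_Cseries_plus (a b : nat -> C) (l m : C) :
  is_Cseries a l -> is_Cseries b m -> is_Cseries (fun n => a n + b n) (l + m).
Proof. exact (is_series_plus (V := C_NormedModule) a b l m). Qed.

Lemma is_Cseries_scal (c : C) (a : nat -> C) (l : C) :
  is_Cseries a l -> is_Cseries (fun n => c * a n) (c * l).
Proof. exact (is_series_scal (V := C_NormedModule) c a l). Qed.

Lemma is_Cseries_minus (a b : nat -> C) (l m : C) :
  is_Cseries a l -> is_Cseries b m -> is_Cseries (fun n => a n - b n) (l - m).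
Proof.
  intros Ha Hb. apply is_Cseries_ext with (fun n => a n + (- (1)) * b n).
  - intro n. ring.
  - replace (l - m) with (l + (- (1)) * m) by ring.
    apply is_Cseries_plus; [assumption|]. now apply is_Cseries_scal.
Qed.

Lemma is_Cseries_cons (a : nat -> C) (l : C) :
  is_Cseries a l <-> is_Cseries (fun n => a (S n)) (l - a 0%nat).
Proof.
  split; intro H.
  - apply (is_series_incr_1 (V := C_NormedModule) a (l - a 0%nat)).
    replace (plus _ _) with l; [assumption|]. change (@eq C l (l - a 0%nat + a 0%nat)). ring.
  - apply (is_series_decr_1 (V := C_NormedModule) a l). exact H.
Qed.

Lemma is_Cseries_zero : is_Cseries (fun _ => RtoC 0) (RtoC 0).
Proof.
  apply is_Cseries_tends. intros eps He. exists 0%nat. intros n _.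
  assert (E : @eq C (Csum_n (fun _ => RtoC 0) n) 0).
  { induction n as [|n IH]; [apply sum_O|]. rewrite sum_n_S_C, IH. ring. }
  rewrite E. replace (0 - 0) with (RtoC 0) by ring. now rewrite Cmod_0.
Qed.

Lemma ex_Cseries_le (a : nat -> C) (b : nat -> R) :
  (forall n, Cmod (a n) <= b n)%R -> ex_series b -> exists l : C, is_Cseries a l.
Proof.
  intros H Hb. apply (ex_series_le (V := C_CompleteNormedModule) a b); assumption.
Qed.

Lemma Cmod_sum_n_le (a : nat -> C) n :
  (Cmod (Csum_n a n) <= sum_n (fun k => Cmod (a k)) n)%R.
Proof.
  induction n as [|n IH].
  - rewrite !sum_O. lra.
  - rewrite sum_n_S_C, sum_n_S_R.
    apply Rle_trans with (1 := Cmod_triangle _ _). lra.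
Qed.

Lemma sum_n_le_R (a b : nat -> R) n :
  (forall k, a k <= b k)%R -> (sum_n a n <= sum_n b n)%R.
Proof.
  intro H. induction n as [|n IH].
  - rewrite !sum_O. apply H.
  - rewrite !sum_n_S_R. specialize (H (S n)). lra.
Qed.

Lemma sum_n_ext_R (a b : nat -> R) n :
  (forall k, a k = b k) -> sum_n a n = sum_n b n :> R.
Proof. apply sum_n_ext. Qed.

Lemma sum_n_incr_R (a : nat -> R) n m :
  (forall k, 0 <= a k)%R -> (n <= m)%nat -> (sum_n a n <= sum_n a m)%R.
Proof.
  intros H Hnm. induction Hnm as [|m Hnm IH]; [lra|].
  rewrite sum_n_S_R. specialize (H (S m)). lra.
Qed.

Lemma term_le_sum_n (a : nat -> R) n :
  (forall k, 0 <= a k)%R -> (a n <= sum_n a n)%R.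
Proof.
  intro Ha. destruct n as [|n]; [rewrite sum_O; lra|].
  assert (H := sum_n_incr_R a 0 n Ha ltac:(lia)).
  rewrite sum_O in H. specialize (Ha 0%nat). rewrite sum_n_S_R. lra.
Qed.

Lemma ex_series_bounded (a : nat -> R) M :
  (forall k, 0 <= a k)%R -> (forall n, sum_n a n <= M)%R -> ex_series a.
Proof.
  intros Ha HM.
  destruct (ex_finite_lim_seq_incr (sum_n a) M) as [l Hl]; auto.
  - intro n. apply sum_n_incr_R; auto.
  - now exists l.
Qed.

Lemma sum_n_le_Series (a : nat -> R) n :
  (forall k, 0 <= a k)%R -> ex_series a -> (sum_n a n <= Series a)%R.
Proof.
  intros Ha Hex.
  apply (is_lim_seq_incr_compare (sum_n a) (Series a)).
  - exact (Series_correct a Hex).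
  - intro k. apply sum_n_incr_R; auto.
Qed.

Lemma is_Cseries_norm_le (a : nat -> C) (l : C) M :
  is_Cseries a l -> (forall n, sum_n (fun k => Cmod (a k)) n <= M)%R ->
  (Cmod l <= M)%R.
Proof.
  intros H HM. apply is_Cseries_tends in H.
  apply (Ctends_norm_le _ _ M) in H; [assumption|]. exists 0%nat. intros n _.
  apply Rle_trans with (1 := Cmod_sum_n_le _ _). apply HM.
Qed.

(** Dominated convergence for series: the tail is small uniformly in [L], and a
    finite head converges term by term. *)
Lemma tannery (x : nat -> nat -> C) (y : nat -> C) (M : nat -> R) (X : nat -> C) :
  ex_series M ->
  (forall L j, Cmod (x L j) <= M j)%R ->
  (forall j, Ctends (fun L => x L j) (y j)) ->
  (forall L, is_Cseries (x L) (X L)) ->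
  exists Y : C, is_Cseries y Y /\ Ctends X Y.
Proof.
  intros HM Hx Hy HX.
  assert (Hym : forall j, (Cmod (y j) <= M j)%R).
  { intro j. apply (Ctends_norm_le (fun L => x L j)); [exists 0%nat; auto|auto]. }
  assert (HMpos : forall j, (0 <= M j)%R).
  { intro j. apply Rle_trans with (2 := Hym j). apply Cmod_ge_0. }
  destruct (ex_Cseries_le y M Hym HM) as [Y HY].
  exists Y. split; [assumption|]. intros eps He.
  assert (Htail : exists J, forall n, (sum_n M n - sum_n M J < eps / 8)%R).
  { assert (HS := Series_correct M HM).
    assert (Hl : is_lim_seq (sum_n M) (Series M)) by exact HS.
    apply is_lim_seq_spec in Hl.
    destruct (Hl (mkposreal (eps / 8) ltac:(lra))) as [J HJ]. exists J. intro n.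
    specialize (HJ J ltac:(lia)). simpl in HJ.
    assert (Hn := sum_n_le_Series M n HMpos HM).
    apply Rabs_def2 in HJ. lra. }
  destruct Htail as [J HJ].
  assert (Hhead : forall K, exists N, forall L, (N <= L)%nat ->
            (sum_n (fun j => Cmod (x L j - y j)) K < eps / 4)%R).
  { intro K.
    assert (G : forall d, (0 < d)%R -> exists N, forall L, (N <= L)%nat ->
            (sum_n (fun j => Cmod (x L j - y j)) K < d)%R).
    { induction K as [|K IH]; intros d Hd.
      - destruct (Hy 0%nat d Hd) as [N HN]. exists N. intros L HL.
        rewrite sum_O. auto.
      - destruct (IH (d / 2)%R) as [N HN]; [lra|].
        destruct (Hy (S K) (d / 2)%R) as [N' HN']; [lra|].
        exists (N + N')%nat. intros L HL. rewrite sum_n_S_R.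
        specialize (HN L ltac:(lia)). specialize (HN' L ltac:(lia)). simpl in HN'. lra. }
    apply G. lra. }
  destruct (Hhead J) as [N HN]. exists N. intros L HL.
  specialize (HN L HL).
  apply Rle_lt_trans with (eps / 2)%R; [|lra].
  apply (is_Cseries_norm_le _ _ _ (is_Cseries_minus _ _ _ _ (HX L) HY)).
  assert (Hd : forall j, (Cmod (x L j - y j) <= 2 * M j)%R).
  { intro j. unfold Cminus. apply Rle_trans with (1 := Cmod_triangle _ _).
    rewrite Cmod_opp. specialize (Hx L j). specialize (Hym j). lra. }
  intro n. destruct (Nat.le_gt_cases n J) as [Hn|Hn].
  - apply Rle_trans with (sum_n (fun j => Cmod (x L j - y j)) J); [|lra].
    apply sum_n_incr_R; [intro; apply Cmod_ge_0|assumption].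
  - assert (Hb : (sum_n (fun j => Cmod (x L j - y j)) n
                  <= sum_n (fun j => Cmod (x L j - y j)) J
                     + 2 * (sum_n M n - sum_n M J))%R).
    { apply Nat.lt_le_incl in Hn. induction Hn as [|n Hn IH]; [lra|].
      rewrite !sum_n_S_R. specialize (Hd (S n)). lra. }
    specialize (HJ n). lra.
Qed.

(** Tannery's theorem applied to the partial sums of the rows. *)
Lemma fubini (a : nat -> nat -> C) (M : nat -> R) (A B : nat -> C) :
  ex_series M ->
  (forall j n, sum_n (fun l => Cmod (a j l)) n <= M j)%R ->
  (forall j, is_Cseries (a j) (A j)) ->
  (forall l, is_Cseries (fun j => a j l) (B l)) ->
  exists T : C, is_Cseries A T /\ is_Cseries B T.
Proof.
  intros HM Ha HA HB.
  destruct (tannery (fun L j => Csum_n (a j) L) A M (Csum_n B)) as [T [H1 H2]]; auto.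
  - intros L j. apply Rle_trans with (1 := Cmod_sum_n_le _ _). apply Ha.
  - intro j. apply is_Cseries_tends. apply HA.
  - intro L. induction L as [|L IH].
    + rewrite sum_O. apply is_Cseries_ext with (2 := HB 0%nat).
      intro j. now rewrite sum_O.
    + rewrite sum_n_S_C.
      apply is_Cseries_ext with (2 := is_Cseries_plus _ _ _ _ IH (HB (S L))).
      intro j. now rewrite sum_n_S_C.
  - exists T. split; [assumption|]. now apply is_Cseries_tends.
Qed.

(** * Power series absolutely convergent on a disc *)

(** [M] bounds the norm [sum_l |c_l| r^l] of the Taylor coefficients at [s0].
    The bound is put on partial sums so that no limit has to be named. *)
Definition wiener (s0 : C) (r M : R) (f : C -> C) : Prop :=
  exists c : nat -> C,
    (forall n, (sum_n (fun l => (Cmod (c l) * r ^ l)%R) n <= M)%R) /\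
    forall s, (Cmod (s - s0) < r)%R ->
      is_Cseries (fun l => c l * (s - s0) ^ l) (f s).

Lemma wiener_nonneg s0 r M f : wiener s0 r M f -> (0 <= M)%R.
Proof.
  intros [c [Hc _]]. specialize (Hc 0%nat). rewrite sum_O in Hc. simpl in Hc.
  assert (H := Cmod_ge_0 (c 0%nat)). lra.
Qed.

Lemma wiener_ext s0 r M f g :
  (forall s, (Cmod (s - s0) < r)%R -> f s = g s) ->
  wiener s0 r M f -> wiener s0 r M g.
Proof.
  intros E [c [Hc Hs]]. exists c. split; [assumption|].
  intros s Hr. rewrite <- E; auto.
Qed.

Lemma wiener_weaken s0 r r' M M' f :
  (0 <= r' <= r)%R -> (M <= M')%R -> wiener s0 r M f -> wiener s0 r' M' f.
Proof.
  intros Hr HM [c [Hc Hs]]. exists c. split.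
  - intro n. apply Rle_trans with (2 := HM). apply Rle_trans with (2 := Hc n).
    apply sum_n_le_R. intro k. apply Rmult_le_compat_l; [apply Cmod_ge_0|].
    now apply pow_incr.
  - intros s H. apply Hs. lra.
Qed.

Lemma sum_n_scal_R (c : R) (a : nat -> R) n :
  sum_n (fun k => (c * a k)%R) n = (c * sum_n a n)%R :> R.
Proof.
  induction n as [|n IH]; [now rewrite !sum_O|]. rewrite !sum_n_S_R, IH. ring.
Qed.

Lemma sum_n_shift_R (a : nat -> R) n :
  sum_n a (S n) = (a 0%nat + sum_n (fun k => a (S k)) n)%R :> R.
Proof.
  induction n as [|n IH].
  - rewrite sum_n_S_R, !sum_O. reflexivity.
  - rewrite sum_n_S_R, IH, sum_n_S_R. ring.
Qed.

Lemma sum_n_zero_R n : sum_n (fun _ => 0%R) n = 0%R :> R.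
Proof.
  induction n as [|n IH]; [now rewrite sum_O|]. rewrite sum_n_S_R, IH. ring.
Qed.

Lemma wiener_scal s0 r M f a :
  wiener s0 r M f -> wiener s0 r (Cmod a * M) (fun s => a * f s).
Proof.
  intros [c [Hc Hs]]. exists (fun l => a * c l). split.
  - intro n. rewrite (sum_n_ext_R _ (fun l => (Cmod a * (Cmod (c l) * r ^ l))%R)).
    + rewrite sum_n_scal_R. apply Rmult_le_compat_l; [apply Cmod_ge_0|apply Hc].
    + intro l. rewrite Cmod_mult. ring.
  - intros s H. apply is_Cseries_ext with (fun l => a * (c l * (s - s0) ^ l)).
    + intro l. ring.
    + now apply is_Cseries_scal, Hs.
Qed.

Lemma wiener_plus s0 r M N f g :
  (0 <= r)%R ->
  wiener s0 r M f -> wiener s0 r N g -> wiener s0 r (M + N) (fun s => f s + g s).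
Proof.
  intros Hr [c [Hc Hs]] [d [Hd Ht]]. exists (fun l => c l + d l). split.
  - intro n.
    apply Rle_trans with (sum_n (fun l => (Cmod (c l) * r ^ l)%R) n
                          + sum_n (fun l => (Cmod (d l) * r ^ l)%R) n)%R.
    + induction n as [|n IH].
      * rewrite !sum_O. simpl. assert (H := Cmod_triangle (c 0%nat) (d 0%nat)). lra.
      * rewrite !sum_n_S_R.
        assert (H := Cmod_triangle (c (S n)) (d (S n))).
        apply (Rmult_le_compat_r (r ^ S n)) in H; [lra|now apply pow_le].
    + specialize (Hc n). specialize (Hd n). lra.
  - intros s H.
    apply is_Cseries_ext with (fun l => c l * (s - s0) ^ l + d l * (s - s0) ^ l).
    + intro l. ring.
    + apply is_Cseries_plus; auto.
Qed.

(** Multiplication by [s - s0] shifts the coefficients, so it has norm [r]. *)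
Lemma wiener_shift s0 r M f :
  (0 <= r)%R ->
  wiener s0 r M f -> wiener s0 r (r * M) (fun s => (s - s0) * f s).
Proof.
  intros Hr [c [Hc Hs]].
  exists (fun l => match l with O => RtoC 0 | S k => c k end). split.
  - intro n. destruct n as [|n].
    + rewrite sum_O, Cmod_0. simpl.
      assert (H := Hc 0%nat). rewrite sum_O in H. simpl in H.
      assert (H' := Cmod_ge_0 (c 0%nat)).
      assert (0 <= r * M)%R by (apply Rmult_le_pos; lra). lra.
    + rewrite sum_n_shift_R, Cmod_0.
      rewrite (sum_n_ext_R _ (fun l => (r * (Cmod (c l) * r ^ l))%R)).
      * rewrite sum_n_scal_R. specialize (Hc n).
        apply (Rmult_le_compat_l r) in Hc; [|assumption]. simpl. lra.
      * intro l. simpl. ring.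
  - intros s H. apply is_Cseries_cons.
    apply is_Cseries_ext with (fun l => (s - s0) * (c l * (s - s0) ^ l)).
    + intro l. simpl. ring.
    + replace ((s - s0) * f s - 0 * (s - s0) ^ 0) with ((s - s0) * f s) by (simpl; ring).
      now apply is_Cseries_scal, Hs.
Qed.

Lemma wiener_shift_pow s0 r M f k :
  (0 <= r)%R ->
  wiener s0 r M f -> wiener s0 r (r ^ k * M) (fun s => (s - s0) ^ k * f s).
Proof.
  intros Hr H. induction k as [|k IH].
  - simpl. rewrite Rmult_1_l. apply wiener_ext with (2 := H). intros s _. ring.
  - simpl. rewrite Rmult_assoc.
    apply wiener_ext with (2 := wiener_shift _ _ _ _ Hr IH). intros s _. ring.
Qed.

(** The norm makes these functions a Banach space.  Summing the coefficients of
    fixed index gives the coefficients of the sum, by exchanging two sums. *)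
Lemma wiener_series s0 r (M : nat -> R) (f : nat -> C -> C) (F : C -> C) :
  (0 < r)%R ->
  ex_series M ->
  (forall j, wiener s0 r (M j) (f j)) ->
  (forall s, (Cmod (s - s0) < r)%R -> is_Cseries (fun j => f j s) (F s)) ->
  wiener s0 r (Series M) F.
Proof.
  intros Hr HM Hf HF.
  destruct (functional_choice _ Hf) as [c Hc].
  assert (HMpos : forall j, (0 <= M j)%R) by (intro j; apply (wiener_nonneg _ _ _ _ (Hf j))).
  assert (Hterm : forall j l, (Cmod (c j l) * r ^ l <= M j)%R).
  { intros j l. apply Rle_trans with (2 := proj1 (Hc j) l).
    assert (Hp : forall k, (0 <= Cmod (c j k) * r ^ k)%R).
    { intro k. apply Rmult_le_pos; [apply Cmod_ge_0|apply pow_le; lra]. }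
    exact (term_le_sum_n _ l Hp). }
  assert (Hpow : forall l, (0 < r ^ l)%R) by (intro l; now apply pow_lt).
  assert (Habs : forall l, ex_series (fun j => Cmod (c j l))).
  { intro l. apply (ex_series_le (V := R_CompleteNormedModule) _ (fun j => (/ r ^ l * M j)%R)).
    - intro j. change (Rabs (Cmod (c j l)) <= / r ^ l * M j)%R.
      rewrite Rabs_pos_eq by apply Cmod_ge_0.
      apply Rmult_le_reg_l with (r ^ l)%R; [apply Hpow|].
      rewrite <- Rmult_assoc, Rinv_r, Rmult_1_l; [|specialize (Hpow l); lra].
      rewrite Rmult_comm. apply Hterm.
    - now apply (ex_series_scal_l (K := R_AbsRing) (V := R_NormedModule)). }
  (* [B l] is the coefficient of index [l] of the sum. *)
  destruct (functional_choice (fun l B => is_Cseries (fun j => c j l) B)) as [B HB].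
  { intro l. apply ex_Cseries_le with (2 := Habs l). intro j. lra. }
  exists B. split.
  - assert (HBle : forall l, (Cmod (B l) <= Series (fun j => Cmod (c j l)))%R).
    { intro l. apply (is_Cseries_norm_le _ _ _ (HB l)). intro n.
      apply sum_n_le_Series; [intro; apply Cmod_ge_0|apply Habs]. }
    assert (HD : forall n, exists D,
       is_series (fun j => sum_n (fun l => (Cmod (c j l) * r ^ l)%R) n) D /\
       (sum_n (fun l => (Cmod (B l) * r ^ l)%R) n <= D)%R).
    { assert (HT : forall l, is_series (fun j => (Cmod (c j l) * r ^ l)%R)
                               (Series (fun j => Cmod (c j l)) * r ^ l)%R).
      { intro l. apply is_series_scal_r. now apply Series_correct. }
      assert (HBr : forall l, (Cmod (B l) * r ^ l <= Series (fun j => Cmod (c j l)) * r ^ l)%R).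
      { intro l. apply Rmult_le_compat_r; [specialize (Hpow l); lra|apply HBle]. }
      induction n as [|n [D [H1 H2]]].
      - eexists. split.
        + apply is_series_ext with (2 := HT 0%nat). intro j. now rewrite sum_O.
        + rewrite sum_O. apply HBr.
      - exists (D + Series (fun j => Cmod (c j (S n))) * r ^ (S n))%R. split.
        + apply (is_series_ext (K := R_AbsRing) (V := R_NormedModule)) with
            (2 := is_series_plus (V := R_NormedModule) _ _ _ _ H1 (HT (S n))).
          intro j. now rewrite sum_n_S_R.
        + rewrite sum_n_S_R. specialize (HBr (S n)). simpl in *. lra. }
    intro n. destruct (HD n) as [D [H1 H2]]. apply Rle_trans with (1 := H2).
    rewrite <- (is_series_unique _ _ H1). apply Series_le; [|assumption].
    intro j. split; [|apply (proj1 (Hc j))].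
    apply Rle_trans with (2 := sum_n_incr_R (fun l => (Cmod (c j l) * r ^ l)%R) 0 n
       ltac:(intro; apply Rmult_le_pos; [apply Cmod_ge_0|apply pow_le; lra]) ltac:(lia)).
    rewrite sum_O. apply Rmult_le_pos; [apply Cmod_ge_0|apply pow_le; lra].
  - intros s Hs.
    destruct (fubini (fun j l => c j l * (s - s0) ^ l) M (fun j => f j s)
                (fun l => B l * (s - s0) ^ l)) as [T [H1 H2]]; auto.
    + intros j n. apply Rle_trans with (2 := proj1 (Hc j) n). apply sum_n_le_R.
      intro k. rewrite Cmod_mult, Cmod_pow.
      apply Rmult_le_compat_l; [apply Cmod_ge_0|]. apply pow_incr.
      split; [apply Cmod_ge_0|lra].
    + intro j. apply (proj2 (Hc j)). assumption.
    + intro l. apply is_Cseries_ext with (fun j => (s - s0) ^ l * c j l).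
      * intro j. ring.
      * rewrite Cmult_comm. now apply is_Cseries_scal.
    + now rewrite (is_Cseries_unique _ _ _ (HF s Hs) H1).
Qed.

(** The norm is submultiplicative: expand the first factor into monomials, each
    of which only shifts the coefficients of the second one. *)
Lemma wiener_mult s0 r M N f g :
  (0 < r)%R ->
  wiener s0 r M f -> wiener s0 r N g -> wiener s0 r (M * N) (fun s => f s * g s).
Proof.
  intros Hr [c [Hc Hs]] Hg.
  assert (HN := wiener_nonneg _ _ _ _ Hg).
  assert (Hpos : forall l, (0 <= Cmod (c l) * r ^ l)%R).
  { intro l. apply Rmult_le_pos; [apply Cmod_ge_0|apply pow_le; lra]. }
  assert (Hex := ex_series_bounded _ M Hpos Hc).
  assert (Hle : (Series (fun l => (Cmod (c l) * r ^ l)%R) <= M)%R).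
  { assert (Hl : is_lim_seq (sum_n (fun l => (Cmod (c l) * r ^ l)%R))
                  (Series (fun l => (Cmod (c l) * r ^ l)%R))) by exact (Series_correct _ Hex).
    exact (is_lim_seq_le _ (fun _ => M) _ M Hc Hl (is_lim_seq_const M)). }
  apply wiener_weaken with (r := r) (M := Series (fun l => (Cmod (c l) * r ^ l * N)%R));
    [lra| |].
  - rewrite Series_scal_r. now apply Rmult_le_compat_r.
  - apply wiener_series with (f := fun l s => c l * ((s - s0) ^ l * g s)); auto.
    + now apply ex_series_scal_r.
    + intro l. rewrite Rmult_assoc. apply wiener_scal. apply wiener_shift_pow; [lra|assumption].
    + intros s H. apply is_Cseries_ext with (fun l => g s * (c l * (s - s0) ^ l)).
      * intro l. ring.
      * rewrite Cmult_comm. now apply is_Cseries_scal, Hs.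
Qed.

Lemma wiener_const s0 r a : wiener s0 r (Cmod a) (fun _ => a).
Proof.
  exists (fun l => match l with O => a | S _ => RtoC 0 end). split.
  - intro n. destruct n as [|n].
    + rewrite sum_O. simpl. lra.
    + rewrite sum_n_shift_R. simpl.
      rewrite (sum_n_ext_R _ (fun _ => 0%R)).
      * rewrite sum_n_zero_R. lra.
      * intro l. rewrite Cmod_0. ring.
  - intros s _. apply is_Cseries_cons.
    apply is_Cseries_ext with (fun _ => RtoC 0).
    + intro l. ring.
    + replace (a - a * (s - s0) ^ 0) with (RtoC 0) by (simpl; ring).
      apply is_Cseries_zero.
Qed.

Lemma wiener_id s0 r : (0 <= r)%R -> wiener s0 r (Cmod s0 + r) (fun s => s).
Proof.
  intro Hr.
  apply wiener_ext with (fun s => s0 + (s - s0) * 1).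
  - intros s _. ring.
  - apply wiener_plus; [assumption|apply wiener_const|].
    replace r with (r * Cmod 1)%R at 2 by (rewrite Cmod_1; ring).
    apply wiener_shift; [assumption|apply wiener_const].
Qed.

(** * Analytic functions *)

Definition analytic_at (f : C -> C) (s0 : C) : Prop :=
  exists r M : R, (0 < r)%R /\ wiener s0 r M f.

Lemma pow_n_Cpow (x : C) n : pow_n (K := C_Ring) x n = x ^ n.
Proof. induction n as [|n IH]; simpl; [reflexivity|]. now rewrite <- IH. Qed.

Lemma is_pseries_Cseries (c : nat -> C) (x w : C) :
  is_pseries (K := C_AbsRing) (V := C_NormedModule) c x w <->
  is_Cseries (fun l => c l * x ^ l) w.
Proof.
  assert (E : forall n, pow_n (K := C_Ring) x n * c n = c n * x ^ n :> C).
  { intro n. rewrite pow_n_Cpow. ring. }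
  unfold is_pseries. split; apply is_series_ext; intro n;
    [|symmetry]; exact (E n).
Qed.

Lemma is_Cseries_bounded (a : nat -> C) (l : C) :
  is_Cseries a l -> exists K, forall n, (Cmod (a n) <= K)%R.
Proof.
  intro H.
  destruct (filterlim_bounded (K := C_AbsRing) (V := C_NormedModule) (Csum_n a)
             (ex_intro _ l H)) as [K HK].
  assert (HK' : forall n, (Cmod (Csum_n a n) <= K)%R) by exact HK.
  exists (K + K)%R. intros [|n].
  - specialize (HK' 0%nat). rewrite sum_O in HK'.
    assert (H0 := Cmod_ge_0 (a 0%nat)). lra.
  - assert (H0 := HK' n). assert (H1 := HK' (S n)). rewrite sum_n_S_C in H1.
    replace (a (S n)) with ((Csum_n a n + a (S n)) + - Csum_n a n) by ring.
    apply Rle_trans with (1 := Cmod_triangle _ _). rewrite Cmod_opp. lra.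
Qed.

Lemma sum_n_geom_half n : (sum_n (fun k => ((/ 2) ^ k)%R) n <= 2)%R.
Proof.
  assert (H : sum_n (fun k => ((/ 2) ^ k)%R) n = (2 - (/ 2) ^ n)%R :> R).
  { induction n as [|n IH]; [rewrite sum_O; simpl; lra|].
    rewrite sum_n_S_R, IH. simpl. lra. }
  rewrite H. assert (0 < (/ 2) ^ n)%R by (apply pow_lt; lra). lra.
Qed.

(** A series that converges at distance [r / 2] has bounded terms there, hence
    is dominated by a geometric series of ratio [1 / 2] at distance [r / 4]. *)
Lemma analytic_on_iff D f :
  analytic_on D f <-> forall s0, D s0 -> analytic_at f s0.
Proof.
  split; intros H s0 Hs0.
  - destruct (H s0 Hs0) as [r [c [Hr Hc]]].
    assert (Hhalf : is_Cseries (fun l => c l * (RtoC (r / 2)) ^ l) (f (s0 + RtoC (r / 2)))).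
    { assert (E : s0 + RtoC (r / 2) - s0 = RtoC (r / 2)) by ring.
      rewrite <- is_pseries_Cseries. rewrite <- E at 1. apply Hc. rewrite E, Cmod_R.
      rewrite Rabs_pos_eq; lra. }
    destruct (is_Cseries_bounded _ _ Hhalf) as [K HK].
    exists (r / 4)%R, (K * 2)%R. split; [lra|]. exists c. split.
    + intro n. apply Rle_trans with (sum_n (fun k => (K * (/ 2) ^ k)%R) n).
      * apply sum_n_le_R. intro k. specialize (HK k).
        rewrite Cmod_mult, Cmod_pow, Cmod_R, Rabs_pos_eq in HK by lra.
        replace (r / 4)%R with (r / 2 * / 2)%R by field.
        rewrite Rpow_mult_distr, <- Rmult_assoc.
        apply Rmult_le_compat_r; [apply pow_le; lra|assumption].
      * rewrite sum_n_scal_R. apply Rmult_le_compat_l; [|apply sum_n_geom_half].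
        apply Rle_trans with (2 := HK 0%nat). apply Cmod_ge_0.
    + intros s Hs. apply is_pseries_Cseries, Hc. lra.
  - destruct (H s0 Hs0) as [r [M [Hr [c [_ Hc]]]]]. exists r, c. split; [assumption|].
    intros s Hs. apply is_pseries_Cseries. auto.
Qed.

Lemma analytic_at_ext f g s0 d :
  (0 < d)%R -> (forall s, (Cmod (s - s0) < d)%R -> f s = g s) ->
  analytic_at f s0 -> analytic_at g s0.
Proof.
  intros Hd E [r [M [Hr H]]].
  exists (Rmin r d), M. split; [now apply Rmin_glb_lt|].
  apply wiener_ext with f.
  - intros s Hs. apply E. apply Rlt_le_trans with (1 := Hs). apply Rmin_r.
  - apply wiener_weaken with (3 := H); [|lra].
    split; [apply Rmin_glb; lra|apply Rmin_l].
Qed.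

Lemma analytic_at_plus f g s0 :
  analytic_at f s0 -> analytic_at g s0 -> analytic_at (fun s => f s + g s) s0.
Proof.
  intros [r [M [Hr H]]] [r' [M' [Hr' H']]].
  assert (Hm : (0 < Rmin r r')%R) by now apply Rmin_glb_lt.
  exists (Rmin r r'), (M + M')%R. split; [assumption|]. apply wiener_plus; [lra| |].
  - apply wiener_weaken with (3 := H); [split; [lra|apply Rmin_l]|lra].
  - apply wiener_weaken with (3 := H'); [split; [lra|apply Rmin_r]|lra].
Qed.

Lemma analytic_at_mult f g s0 :
  analytic_at f s0 -> analytic_at g s0 -> analytic_at (fun s => f s * g s) s0.
Proof.
  intros [r [M [Hr H]]] [r' [M' [Hr' H']]].
  assert (Hm : (0 < Rmin r r')%R) by now apply Rmin_glb_lt.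
  exists (Rmin r r'), (M * M')%R. split; [assumption|]. apply wiener_mult; [lra| |].
  - apply wiener_weaken with (3 := H); [split; [lra|apply Rmin_l]|lra].
  - apply wiener_weaken with (3 := H'); [split; [lra|apply Rmin_r]|lra].
Qed.

Lemma analytic_at_const a s0 : analytic_at (fun _ => a) s0.
Proof. exists 1%R, (Cmod a). split; [lra|apply wiener_const]. Qed.

Lemma analytic_at_id s0 : analytic_at (fun s => s) s0.
Proof. exists 1%R, (Cmod s0 + 1)%R. split; [lra|apply wiener_id; lra]. Qed.

Lemma analytic_at_minus f g s0 :
  analytic_at f s0 -> analytic_at g s0 -> analytic_at (fun s => f s - g s) s0.
Proof.
  intros Hf Hg. apply analytic_at_ext with (fun s => f s + (- (1)) * g s) 1%R.
  - lra.
  - intros s _. ring.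
  - apply analytic_at_plus; [assumption|].
    apply analytic_at_mult; [apply analytic_at_const|assumption].
Qed.

Lemma analytic_at_sum_n (f : nat -> C -> C) n s0 :
  (forall k, (k <= n)%nat -> analytic_at (f k) s0) ->
  analytic_at (fun s => Csum_n (fun k => f k s) n) s0.
Proof.
  intro H. induction n as [|n IH].
  - apply analytic_at_ext with (f 0%nat) 1%R; [lra| |apply H; lia].
    intros s _. now rewrite sum_O.
  - apply analytic_at_ext with (fun s => Csum_n (fun k => f k s) n + f (S n) s) 1%R.
    + lra.
    + intros s _. now rewrite sum_n_S_C.
    + apply analytic_at_plus; [|apply H; lia]. apply IH. intros k Hk. apply H. lia.
Qed.

Lemma wiener_translate s0 r M f a :
  wiener (s0 + a) r M f -> wiener s0 r M (fun s => f (s + a)).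
Proof.
  intros [c [Hc Hs]]. exists c. split; [assumption|]. intros s H.
  specialize (Hs (s + a)). replace (s + a - (s0 + a)) with (s - s0) in Hs by ring. auto.
Qed.

Lemma analytic_at_translate f a s0 :
  analytic_at f (s0 + a) -> analytic_at (fun s => f (s + a)) s0.
Proof.
  intros [r [M [Hr H]]]. exists r, M. split; [assumption|]. now apply wiener_translate.
Qed.

(** Geometric series in [(s - s0) / (a - s0)]. *)
Lemma analytic_at_inv_sub (a s0 : C) : s0 <> a -> analytic_at (fun s => / (s - a)) s0.
Proof.
  intro Hne.
  assert (Hd : s0 - a <> 0).
  { intro E. apply Hne. replace s0 with (s0 - a + a) by ring. rewrite E. ring. }
  assert (Hp : (0 < Cmod (s0 - a))%R) by now apply Cmod_gt_0.
  apply analytic_on_iff with (D := fun s => s = s0); [|reflexivity].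
  intros s1 ->. exists (Cmod (s0 - a)), (fun l => / (s0 - a) * (- / (s0 - a)) ^ l).
  split; [assumption|]. intros s Hs. apply is_pseries_Cseries.
  set (q := - ((s - s0) / (s0 - a))).
  assert (Hq : (Cmod q < 1)%R).
  { unfold q. rewrite Cmod_opp, Cmod_div by assumption.
    apply Rmult_lt_reg_r with (Cmod (s0 - a)); [assumption|].
    unfold Rdiv. rewrite Rmult_assoc, Rinv_l; lra. }
  assert (H1q : 1 - q <> 0).
  { intro E. assert (E' : q = 1). { replace q with (1 - (1 - q)) by ring. rewrite E. ring. }
    rewrite E', Cmod_1 in Hq. lra. }
  assert (Hsa : s - a <> 0).
  { intro E. apply H1q. unfold q.
    replace (1 - - ((s - s0) / (s0 - a))) with ((s - a) / (s0 - a)) by (field; assumption).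
    rewrite E. field. assumption. }
  apply is_Cseries_ext with (fun l => / (s0 - a) * q ^ l).
  { intro l. replace q with ((- / (s0 - a)) * (s - s0)).
    - rewrite Cpow_mult_l. ring.
    - unfold q. field. assumption. }
  replace (/ (s - a)) with (/ (s0 - a) * / (1 - q)).
  2:{ unfold q. field. repeat split; auto. }
  apply is_Cseries_scal.
  assert (Hex : ex_series (fun l => (Cmod q ^ l)%R)).
  { exists (/ (1 - Cmod q))%R. apply is_series_geom. rewrite Rabs_pos_eq; [assumption|apply Cmod_ge_0]. }
  destruct (ex_Cseries_le (fun l => q ^ l) _ ltac:(intro l; right; apply Cmod_pow) Hex)
    as [w Hw].
  assert (E : q * w = w - 1).
  { symmetry. apply (is_Cseries_unique (fun l => q ^ (1 + l))).
    - apply is_Cseries_cons in Hw. exact Hw.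
    - exact (is_Cseries_scal q _ w Hw). }
  assert (E' : (1 - q) * w = 1) by (replace ((1 - q) * w) with (w - q * w) by ring;
    rewrite E; ring).
  replace (/ (1 - q)) with w; [assumption|].
  transitivity ((1 - q) * w / (1 - q)); [field|rewrite E'; field]; assumption.
Qed.

(** * The identity theorem *)

Definition vanishes_near (f : C -> C) (s0 : C) : Prop :=
  exists d : R, (0 < d)%R /\ forall s, (Cmod (s - s0) < d)%R -> f s = 0.

(** Zeros are isolated.  If [c l] is the first nonzero coefficient, then at a
    zero at distance [d] the term [c l * d^l] is cancelled by the later ones,
    which are at most [(d / r)^(l+1) * M]; this bounds [|c l|] by a multiple
    of [d]. *)
Lemma vanishes_near_of_cluster f s0 :
  analytic_at f s0 ->
  (forall d, (0 < d)%R -> exists s, s <> s0 /\ (Cmod (s - s0) < d)%R /\ f s = 0) ->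
  vanishes_near f s0.
Proof.
  intros [r [M [Hr [c [Hc Hs]]]]] Hz.
  assert (Hcoef : forall l, c l = 0).
  { intro l. induction l as [l IH] using (well_founded_induction Wf_nat.lt_wf).
    destruct (Ceq_dec (c l) 0) as [|Hne]; [assumption|exfalso].
    apply Cmod_gt_0 in Hne.
    assert (HM : (0 <= M)%R).
    { specialize (Hc 0%nat). rewrite sum_O in Hc. simpl in Hc.
      assert (H0 := Cmod_ge_0 (c 0%nat)). lra. }
    assert (Hrl : (0 < r ^ S l)%R) by now apply pow_lt.
    (* [|c l| <= K * d] will hold at every zero at distance [d < r]. *)
    set (K := (M / r ^ S l)%R).
    assert (HK : (0 <= K)%R) by (apply Rmult_le_pos; [assumption|left; now apply Rinv_0_lt_compat]).
    destruct (Hz (Rmin r (Cmod (c l) / (K + 1)))%R) as [s [Hss0 [Hsd Hfs]]].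
    { apply Rmin_glb_lt; [assumption|]. apply Rdiv_lt_0_compat; lra. }
    assert (Hsr : (Cmod (s - s0) < r)%R) by (apply Rlt_le_trans with (1 := Hsd); apply Rmin_l).
    assert (Hsc : (Cmod (s - s0) < Cmod (c l) / (K + 1))%R)
      by (apply Rlt_le_trans with (1 := Hsd); apply Rmin_r).
    set (d := Cmod (s - s0)) in *.
    assert (Hd : (0 < d)%R).
    { apply Cmod_gt_0. intro E. apply Hss0. replace s with (s - s0 + s0) by ring.
      rewrite E. ring. }
    specialize (Hs s Hsr). rewrite Hfs in Hs. apply is_Cseries_tends in Hs.
    set (a := fun k => c k * (s - s0) ^ k) in *.
    assert (Hterm : forall k, (l < k)%nat ->
              (Cmod (a k) <= (d / r) ^ S l * (Cmod (c k) * r ^ k))%R).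
    { intros k Hk. unfold a. rewrite Cmod_mult, Cmod_pow. fold d.
      replace d with (d / r * r)%R at 1 by (field; lra).
      rewrite Rpow_mult_distr.
      replace k with (S l + (k - S l))%nat at 2 by lia. rewrite pow_add.
      assert (Hq : ((d / r) ^ (k - S l) <= 1)%R).
      { rewrite <- (pow1 (k - S l)). apply pow_incr. split.
        - left. now apply Rdiv_lt_0_compat.
        - apply Rmult_le_reg_r with r; [assumption|]. unfold Rdiv.
          rewrite Rmult_assoc, Rinv_l; lra. }
      assert (Hnn : (0 <= (d / r) ^ S l * (Cmod (c k) * r ^ k))%R).
      { apply Rmult_le_pos; [apply pow_le; left; now apply Rdiv_lt_0_compat|].
        apply Rmult_le_pos; [apply Cmod_ge_0|apply pow_le; lra]. }
      apply (Rmult_le_compat_l _ _ _ Hnn) in Hq. lra. }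
    assert (Hsum : forall n, (n < l)%nat -> Csum_n a n = RtoC 0 :> C).
    { intros n Hn. induction n as [|n IHn].
      - rewrite sum_O. unfold a. rewrite IH by lia. ring.
      - rewrite sum_n_S_C, IHn by lia. unfold a. rewrite IH by lia. ring. }
    assert (Hpart : forall n, (l <= n)%nat ->
       (Cmod (Csum_n a n - a l) <= (d / r) ^ S l * sum_n (fun k => Cmod (c k) * r ^ k) n)%R).
    { intros n Hn. induction Hn as [|n Hn IHn].
      - assert (E : Csum_n a l - a l = 0).
        { destruct l as [|l]; [rewrite sum_O; ring|]. rewrite sum_n_S_C, Hsum by lia. ring. }
        rewrite E, Cmod_0. apply Rmult_le_pos.
        + apply pow_le. left. now apply Rdiv_lt_0_compat.
        + apply Rle_trans with (sum_n (fun _ => 0%R) l); [rewrite sum_n_zero_R; lra|].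
          apply sum_n_le_R. intro k. apply Rmult_le_pos; [apply Cmod_ge_0|apply pow_le; lra].
      - rewrite sum_n_S_C, sum_n_S_R.
        replace (Csum_n a n + a (S n) - a l) with (Csum_n a n - a l + a (S n)) by ring.
        apply Rle_trans with (1 := Cmod_triangle _ _).
        specialize (Hterm (S n) ltac:(lia)). simpl in *. lra. }
    assert (Hal : (Cmod (a l) <= (d / r) ^ S l * M)%R).
    { replace (a l) with (- (0 + - a l)) by ring. rewrite Cmod_opp.
      apply (Ctends_norm_le (fun n => Csum_n a n + - a l)).
      - exists l. intros n Hn. apply Rle_trans with (1 := Hpart n Hn).
        apply Rmult_le_compat_l; [|apply Hc]. apply pow_le. left. now apply Rdiv_lt_0_compat.
      - apply Ctends_plus; [assumption|]. intros eps He. exists 0%nat. intros n _.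
        replace (- a l - - a l) with (RtoC 0) by ring. now rewrite Cmod_0. }
    unfold a in Hal. rewrite Cmod_mult, Cmod_pow in Hal. fold d in Hal.
    assert (Hdl : (0 < d ^ l)%R) by now apply pow_lt.
    assert (Hfin : (Cmod (c l) <= d * K)%R).
    { apply Rmult_le_reg_r with (d ^ l)%R; [assumption|].
      apply Rle_trans with (1 := Hal). right. unfold K, Rdiv.
      rewrite Rpow_mult_distr, pow_inv. simpl. field.
      split; [|lra]. apply pow_nonzero. lra. }
    assert (Hlt : (d * (K + 1) < Cmod (c l))%R).
    { apply Rmult_lt_reg_r with (/ (K + 1))%R; [apply Rinv_0_lt_compat; lra|].
      rewrite Rmult_assoc, Rinv_r, Rmult_1_r; [exact Hsc|lra]. }
    lra. }
  exists r. split; [assumption|]. intros s Hsr. specialize (Hs s Hsr).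
  apply (is_Cseries_unique _ _ _ Hs).
  apply is_Cseries_ext with (2 := is_Cseries_zero). intro l. rewrite Hcoef. ring.
Qed.

(** Let [T] be the supremum of the parameters up to which [f] vanishes near the
    segment.  The point at [T] is a limit of zeros, so [f] vanishes around it
    too, and [T] could be increased unless it is [1]. *)
Lemma vanishes_along_segment f (p q : C) :
  (forall t : R, (0 <= t <= 1)%R -> analytic_at f (p + t * (q - p))) ->
  vanishes_near f p -> f q = 0.
Proof.
  intros Han Hp.
  set (g := fun t : R => p + RtoC t * (q - p)).
  set (E := fun t : R => (0 <= t <= 1)%R /\
              forall t', (0 <= t' <= t)%R -> vanishes_near f (g t')).
  assert (E0 : E 0%R).
  { split; [lra|]. intros t' Ht'. replace t' with 0%R by lra.
    unfold g. replace (p + 0 * (q - p)) with p by ring. assumption. }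
  destruct (completeness E) as [T [HT1 HT2]].
  { exists 1%R. intros t [Ht _]. lra. }
  { now exists 0%R. }
  assert (HT : (0 <= T <= 1)%R).
  { split; [now apply HT1|]. apply HT2. intros t [Ht _]. lra. }
  set (D := (Cmod (q - p) + 1)%R).
  assert (HD : (0 < D)%R) by (unfold D; assert (H := Cmod_ge_0 (q - p)); lra).
  assert (Hdist : forall t t' : R, (Cmod (g t - g t') <= Rabs (t - t') * D)%R).
  { intros t t'. unfold g.
    replace (p + t * (q - p) - (p + t' * (q - p))) with ((RtoC (t - t')) * (q - p))
      by (rewrite RtoC_minus; ring).
    rewrite Cmod_mult, Cmod_R. apply Rmult_le_compat_l; [apply Rabs_pos|]. unfold D. lra. }
  assert (Hbelow : forall e, (0 < e)%R -> exists t, E t /\ (T - e < t <= T)%R).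
  { intros e He. apply Classical_Prop.NNPP. intro Hn.
    assert (Hub : is_upper_bound E (T - e)).
    { intros t Ht. apply Rnot_lt_le. intro Hlt. apply Hn. exists t. split; [assumption|].
      split; [assumption|]. now apply HT1. }
    apply HT2 in Hub. lra. }
  (* A zero close to [g T] but different from it: [g t], or a point next to it
     when [g t = g T]. *)
  assert (HvT : vanishes_near f (g T)).
  { apply vanishes_near_of_cluster; [now apply Han|].
    intros d Hd.
    destruct (Hbelow (d / (2 * D))%R) as [t [[Ht Hvt] Htt]].
    { apply Rdiv_lt_0_compat; lra. }
    destruct (Hvt t ltac:(lra)) as [e [He Hfe]].
    assert (Hclose : (Cmod (g t - g T) < d / 2)%R).
    { apply Rle_lt_trans with (1 := Hdist t T).
      apply Rlt_le_trans with (d / (2 * D) * D)%R.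
      - apply Rmult_lt_compat_r; [assumption|]. apply Rabs_def1; lra.
      - right. field. lra. }
    destruct (Ceq_dec (g t) (g T)) as [Heq|Hne].
    - set (h := Rmin (e / 2) (d / 2)).
      assert (Hh : (0 < h)%R) by (apply Rmin_glb_lt; lra).
      exists (g t + RtoC h). split; [|split].
      + rewrite <- Heq. intro Ec. apply (f_equal fst) in Ec. simpl in Ec. lra.
      + rewrite <- Heq. replace (g t + h - g t) with (RtoC h) by ring.
        rewrite Cmod_R, Rabs_pos_eq by lra.
        apply Rle_lt_trans with (d / 2)%R; [apply Rmin_r|lra].
      + apply Hfe. replace (g t + h - g t) with (RtoC h) by ring.
        rewrite Cmod_R, Rabs_pos_eq by lra.
        apply Rle_lt_trans with (e / 2)%R; [apply Rmin_l|lra].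
    - exists (g t). split; [assumption|]. split; [lra|]. apply Hfe.
      replace (g t - g t) with (RtoC 0) by ring. now rewrite Cmod_0. }
  destruct HvT as [d [Hd Hfd]].
  set (e := (d / (2 * D))%R).
  assert (He : (0 < e)%R) by (apply Rdiv_lt_0_compat; lra).
  assert (Hnear : forall t, (Rabs (t - T) <= e)%R -> vanishes_near f (g t)).
  { intros t Ht. exists (d / 2)%R. split; [lra|]. intros s Hs. apply Hfd.
    replace (s - g T) with ((s - g t) + (g t - g T)) by ring.
    apply Rle_lt_trans with (1 := Cmod_triangle _ _).
    assert (Hb : (Cmod (g t - g T) <= d / 2)%R).
    { apply Rle_trans with (1 := Hdist t T).
      apply Rle_trans with (e * D)%R; [apply Rmult_le_compat_r; lra|].
      right. unfold e. field. lra. }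
    lra. }
  assert (Hext : E (Rmin 1 (T + e))).
  { split; [split; [apply Rmin_glb; lra|apply Rmin_l]|].
    intros t' [Ht0 Ht']. destruct (Rlt_le_dec t' T) as [Hlt|Hge].
    - destruct (Hbelow (T - t')%R) as [t [[_ Ht] Htt]]; [lra|]. apply Ht. lra.
    - apply Hnear. assert (H2 := Rmin_r 1 (T + e)). rewrite Rabs_pos_eq; lra. }
  assert (HT1' : (1 <= T)%R).
  { apply HT1 in Hext. apply Rnot_lt_le. intro Hlt.
    assert (T < Rmin 1 (T + e))%R by (apply Rmin_glb_lt; lra). lra. }
  assert (Hq : g 1%R = q) by (unfold g; ring).
  destruct (Hnear 1%R) as [d' [Hd' Hf']].
  { replace T with 1%R by lra. rewrite Rminus_diag, Rabs_R0. lra. }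
  rewrite Hq in Hf'. apply Hf'. replace (q - q) with (RtoC 0) by ring. now rewrite Cmod_0.
Qed.

(** * Exponential, logarithm and powers *)

Lemma Cexp_plus z w : Cexp (z + w) = Cexp z * Cexp w.
Proof.
  unfold Cexp, Re, Im. apply injective_projections; simpl;
    rewrite exp_plus, ?cos_plus, ?sin_plus; ring.
Qed.

Lemma Cexp_0 : Cexp 0 = 1.
Proof.
  unfold Cexp. simpl. rewrite exp_0, cos_0, sin_0, Rmult_1_l, Rmult_0_r. reflexivity.
Qed.

Lemma Cmod_Cexp z : Cmod (Cexp z) = exp (Re z).
Proof.
  unfold Cmod, Cexp. simpl fst. simpl snd.
  replace (_ + _)%R with (exp (Re z) ^ 2)%R.
  - rewrite sqrt_pow2; [reflexivity|]. left. apply exp_pos.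
  - assert (H := sin2_cos2 (Im z)). unfold Rsqr in H.
    transitivity (exp (Re z) ^ 2 * (sin (Im z) * sin (Im z) + cos (Im z) * cos (Im z)))%R.
    + rewrite H. ring.
    + ring.
Qed.

Lemma Cexp_neq_0 z : Cexp z <> 0.
Proof. apply Cmod_gt_0. rewrite Cmod_Cexp. apply exp_pos. Qed.

Lemma Cexp_opp z : Cexp (- z) = / Cexp z.
Proof.
  assert (H := Cexp_neq_0 z).
  replace (Cexp (- z)) with (Cexp z * Cexp (- z) * / Cexp z) by (field; assumption).
  rewrite <- Cexp_plus. replace (z + - z) with (RtoC 0) by ring. rewrite Cexp_0. ring.
Qed.

Lemma Cexp_mul_nat n z : Cexp (INR n * z) = Cexp z ^ n.
Proof.
  induction n as [|n IH].
  - simpl. replace (0 * z) with (RtoC 0) by ring. apply Cexp_0.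
  - rewrite S_INR, RtoC_plus. replace ((INR n + 1) * z) with (z + INR n * z) by ring.
    rewrite Cexp_plus, IH. reflexivity.
Qed.

Lemma Re_div_Cmod_bound (z : C) : z <> 0 -> (-1 <= Re z / Cmod z <= 1)%R.
Proof.
  intro Hz. apply Cmod_gt_0 in Hz. assert (H := re_le_Cmod z).
  apply Rabs_le_between in H.
  split; apply Rmult_le_reg_r with (Cmod z); try assumption;
    unfold Rdiv; rewrite Rmult_assoc, Rinv_l; lra.
Qed.

Lemma Cexp_Clog (z : C) : z <> 0 -> Cexp (Clog z) = z.
Proof.
  intro Hz. assert (Hr := Re_div_Cmod_bound z Hz). assert (Hm := Hz).
  apply Cmod_gt_0 in Hm.
  assert (Hsq : (Cmod z ^ 2 = Re z ^ 2 + Im z ^ 2)%R) by apply Cmod2_alt.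
  unfold Cexp, Clog. simpl Re. simpl Im. rewrite exp_ln by assumption.
  assert (Hsin : (sin (acos (Re z / Cmod z)) = Rabs (Im z) / Cmod z)%R).
  { rewrite sin_acos by assumption.
    replace (1 - (Re z / Cmod z)²)%R with ((Im z / Cmod z)²)%R.
    - rewrite sqrt_Rsqr_abs. unfold Rdiv. rewrite Rabs_mult, Rabs_inv.
      now rewrite (Rabs_pos_eq (Cmod z)) by lra.
    - unfold Rsqr. apply Rmult_eq_reg_r with (Cmod z ^ 2)%R; [|apply pow_nonzero; lra].
      field_simplify; lra. }
  unfold Carg. destruct (Rle_dec 0 (Im z)) as [Hi|Hi].
  - rewrite cos_acos, Hsin, Rabs_pos_eq by assumption.
    apply injective_projections; simpl; fold (Re z) (Im z); field; lra.
  - rewrite cos_neg, sin_neg, cos_acos, Hsin by assumption.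
    rewrite Rabs_left by lra.
    apply injective_projections; simpl; fold (Re z) (Im z); field; lra.
Qed.

Lemma Carg_bound z : (Rabs (Carg z) <= PI)%R.
Proof.
  assert (H := acos_bound (Re z / Cmod z)). unfold Carg.
  destruct (Rle_dec 0 (Im z)); apply Rabs_le; lra.
Qed.

Lemma Carg_scale (c : R) (z : C) : (0 < c)%R -> Carg (c * z) = Carg z.
Proof.
  intro Hc. destruct (Ceq_dec z 0) as [->|Hz].
  { now rewrite Cmult_0_r. }
  apply Cmod_gt_0 in Hz. unfold Carg.
  rewrite Cmod_mult, Cmod_R, Rabs_pos_eq by lra.
  replace (Re (c * z)) with (c * Re z)%R by (simpl; unfold Re; ring).
  replace (Im (c * z)) with (c * Im z)%R by (simpl; unfold Im; ring).
  replace (c * Re z / (c * Cmod z))%R with (Re z / Cmod z)%R by (field; lra).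
  destruct (Rle_dec 0 (Im z)) as [H|H], (Rle_dec 0 (c * Im z)) as [H'|H']; auto; exfalso.
  - apply H'. apply Rmult_le_pos; lra.
  - apply H. apply Rmult_le_reg_l with c; lra.
Qed.

Lemma Carg_pos (c : R) : (0 < c)%R -> Carg c = 0%R.
Proof.
  intro Hc. unfold Carg. simpl Re. simpl Im. rewrite Cmod_R, Rabs_pos_eq by lra.
  unfold Rdiv. rewrite Rinv_r, acos_1 by lra.
  destruct (Rle_dec 0 0); [reflexivity|lra].
Qed.

Lemma RtoC_neq_0 (c : R) : (0 < c)%R -> RtoC c <> 0.
Proof. intros Hc E. apply (f_equal fst) in E. simpl in E. lra. Qed.

(** For two complex factors the arguments may add up past [PI]; a positive real
    factor leaves the argument alone. *)
Lemma Cpower_scale (c : R) (z w : C) :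
  (0 < c)%R -> Cpower (c * z) w = Cpower c w * Cpower z w.
Proof.
  intro Hc. assert (Hc0 := RtoC_neq_0 c Hc). unfold Cpower.
  destruct (Ceq_dec c 0) as [E|_]; [contradiction|].
  destruct (Ceq_dec z 0) as [->|Hz].
  - rewrite Cmult_0_r. destruct (Ceq_dec 0 0) as [_|E]; [|now contradiction E].
    destruct (Ceq_dec w 0) as [->|_]; [|ring].
    rewrite Cmult_0_l, Cexp_0. ring.
  - destruct (Ceq_dec (c * z) 0) as [E|_].
    { exfalso. apply Hz. replace z with (/ c * (c * z)) by (field; assumption).
      rewrite E. ring. }
    rewrite <- Cexp_plus. f_equal.
    replace (Clog (c * z)) with (Clog c + Clog z); [ring|].
    unfold Clog. rewrite Carg_scale, Carg_pos by assumption.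
    rewrite Cmod_mult, Cmod_R, Rabs_pos_eq by lra.
    apply Cmod_gt_0 in Hz. rewrite ln_mult by assumption.
    apply injective_projections; simpl; ring.
Qed.

Lemma Cpower_Cexp (z w : C) : z <> 0 -> Cpower z w = Cexp (w * Clog z).
Proof. intro H. unfold Cpower. destruct (Ceq_dec z 0); [contradiction|reflexivity]. Qed.

Lemma Cpower_plus (z w1 w2 : C) :
  z <> 0 -> Cpower z (w1 + w2) = Cpower z w1 * Cpower z w2.
Proof.
  intro H. rewrite !Cpower_Cexp by assumption. rewrite <- Cexp_plus. f_equal. ring.
Qed.

Lemma Cpower_opp (z w : C) : z <> 0 -> Cpower z (- w) = / Cpower z w.
Proof.
  intro H. rewrite !Cpower_Cexp by assumption. rewrite <- Cexp_opp. f_equal. ring.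
Qed.

Lemma Cpower_1 (z : C) : z <> 0 -> Cpower z 1 = z.
Proof. intro H. rewrite Cpower_Cexp, Cmult_1_l by assumption. now apply Cexp_Clog. Qed.

Lemma Cpower_INR (z : C) n : z <> 0 -> Cpower z (INR n) = z ^ n.
Proof.
  intro H. rewrite Cpower_Cexp, Cexp_mul_nat by assumption. now rewrite Cexp_Clog.
Qed.

(** The factor [exp (PI * |Im w|)] accounts for the argument of [z]. *)
Lemma Cmod_Cpower_le (z w : C) :
  z <> 0 -> (Cmod (Cpower z w) <= exp (Re w * ln (Cmod z)) * exp (PI * Rabs (Im w)))%R.
Proof.
  intro H. rewrite Cpower_Cexp, Cmod_Cexp, <- exp_plus by assumption.
  assert (E : Re (w * Clog z) = (Re w * ln (Cmod z) - Im w * Carg z)%R)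
    by (simpl; unfold Re, Im; ring).
  rewrite E.
  assert (Hb := Carg_bound z).
  assert (Hle : (- (Im w * Carg z) <= PI * Rabs (Im w))%R).
  { apply Rle_trans with (Rabs (Im w * Carg z))%R.
    - rewrite <- Rabs_Ropp. apply Rle_abs.
    - rewrite Rabs_mult, Rmult_comm. apply Rmult_le_compat_r; [apply Rabs_pos|assumption]. }
  destruct (Rle_lt_or_eq_dec _ _ Hle) as [Hlt|Heq].
  - left. apply exp_increasing. lra.
  - right. f_equal. lra.
Qed.

(** On the right half-plane the argument has a differentiable closed form. *)
Lemma Carg_atan (z : C) : (0 < Re z)%R -> Carg z = atan (Im z / Re z).
Proof.
  intro Hz.
  assert (Hz0 : z <> 0) by (intros ->; simpl in Hz; lra).
  assert (Hm := Hz0). apply Cmod_gt_0 in Hm.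
  assert (Hsq : (Cmod z ^ 2 = Re z ^ 2 + Im z ^ 2)%R) by apply Cmod2_alt.
  assert (Hac : acos (Re z / Cmod z) = atan (Rabs (Im z) / Re z)).
  { rewrite acos_atan by now apply Rdiv_lt_0_compat. f_equal.
    replace (1 - (Re z / Cmod z)²)%R with ((Im z / Cmod z)²)%R.
    - rewrite sqrt_Rsqr_abs. unfold Rdiv. rewrite Rabs_mult, Rabs_inv.
      rewrite (Rabs_pos_eq (Cmod z)) by lra. field. lra.
    - unfold Rsqr. apply Rmult_eq_reg_r with (Cmod z ^ 2)%R; [|apply pow_nonzero; lra].
      field_simplify; lra. }
  unfold Carg. rewrite Hac. destruct (Rle_dec 0 (Im z)) as [H|H].
  - now rewrite Rabs_pos_eq.
  - rewrite Rabs_left by lra. rewrite <- atan_opp. f_equal. field. lra.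
Qed.

(** * Complex functions of a real variable and the exponential series *)

Definition Cderiv (f : R -> C) (t : R) (d : C) : Prop :=
  is_derive (fun x => Re (f x)) t (Re d) /\ is_derive (fun x => Im (f x)) t (Im d).

Lemma is_derive_mult_R (f g : R -> R) (t d e : R) :
  is_derive f t d -> is_derive g t e ->
  is_derive (fun x => (f x * g x)%R) t (d * g t + f t * e)%R.
Proof.
  intros Hf Hg.
  exact (is_derive_mult (K := R_AbsRing) f g t d e Hf Hg Rmult_comm).
Qed.

Lemma Cderiv_mult f g t d e :
  Cderiv f t d -> Cderiv g t e ->
  Cderiv (fun x => f x * g x) t (d * g t + f t * e).
Proof.
  intros [Hf1 Hf2] [Hg1 Hg2]. split.
  - replace (Re (d * g t + f t * e)) with
      ((Re d * Re (g t) + Re (f t) * Re e) - (Im d * Im (g t) + Im (f t) * Im e))%R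
      by (unfold Re, Im; simpl; ring).
    apply (is_derive_minus (K := R_AbsRing) (V := R_NormedModule)
             (fun x => (Re (f x) * Re (g x))%R) (fun x => (Im (f x) * Im (g x))%R));
      now apply is_derive_mult_R.
  - replace (Im (d * g t + f t * e)) with
      ((Re d * Im (g t) + Re (f t) * Im e) + (Im d * Re (g t) + Im (f t) * Re e))%R
      by (unfold Re, Im; simpl; ring).
    apply (is_derive_plus (K := R_AbsRing) (V := R_NormedModule)
             (fun x => (Re (f x) * Im (g x))%R) (fun x => (Im (f x) * Re (g x))%R));
      now apply is_derive_mult_R.
Qed.

Lemma Cderiv_Cexp f t d :
  Cderiv f t d -> Cderiv (fun x => Cexp (f x)) t (d * Cexp (f t)).
Proof.
  intros [H1 H2].
  assert (He := is_derive_comp (K := R_AbsRing) (V := R_NormedModule) exp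
     (fun x => Re (f x)) t _ _ (is_derive_exp _) H1).
  assert (Hc := is_derive_comp (K := R_AbsRing) (V := R_NormedModule) cos
     (fun x => Im (f x)) t _ _ (is_derive_cos _) H2).
  assert (Hs := is_derive_comp (K := R_AbsRing) (V := R_NormedModule) sin
     (fun x => Im (f x)) t _ _ (is_derive_sin _) H2).
  assert (Hec := is_derive_mult_R _ _ _ _ _ He Hc).
  assert (Hes := is_derive_mult_R _ _ _ _ _ He Hs).
  split.
  - refine (eq_ind _ (is_derive _ t) Hec _ _).
    unfold scal, Cexp, Re, Im; simpl; unfold mult; simpl. ring.
  - refine (eq_ind _ (is_derive _ t) Hes _ _).
    unfold scal, Cexp, Re, Im; simpl; unfold mult; simpl. ring.
Qed.

Lemma Cderiv_scal f t d a : Cderiv f t d -> Cderiv (fun x => a * f x) t (a * d).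
Proof.
  intro H.
  replace (a * d) with (0 * f t + a * d) by ring.
  apply (Cderiv_mult (fun _ => a)); [|assumption].
  split; apply (is_derive_const (K := R_AbsRing) (V := R_NormedModule)).
Qed.

Lemma Cderiv_RtoC t : Cderiv RtoC t 1.
Proof.
  split.
  - exact (is_derive_id (K := R_AbsRing) t).
  - exact (is_derive_const (K := R_AbsRing) (V := R_NormedModule) 0%R t).
Qed.

Lemma Cderiv_eq f t d e : Cderiv f t d -> d = e -> Cderiv f t e.
Proof. now intros H <-. Qed.

Lemma Cderiv_zero_const f :
  (forall t, (0 <= t <= 1)%R -> Cderiv f t 0) -> f 1%R = f 0%R.
Proof.
  intro H.
  assert (G : forall h : R -> R, (forall t, (0 <= t <= 1)%R -> is_derive h t 0%R) ->
              h 1%R = h 0%R).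
  { intros h Hh. destruct (MVT_gen h 0 1 (fun _ => 0%R)) as [c [_ Hc]].
    - intros t Ht. apply Hh. rewrite Rmin_left, Rmax_right in Ht; lra.
    - intros t Ht. rewrite Rmin_left, Rmax_right in Ht by lra.
      apply continuity_pt_filterlim.
      apply (ex_derive_continuous (K := R_AbsRing) (V := R_NormedModule)).
      exists 0%R. apply Hh. lra.
    - lra. }
  apply injective_projections.
  - apply (G (fun t => Re (f t))). intros t Ht. apply (proj1 (H t Ht)).
  - apply (G (fun t => Im (f t))). intros t Ht. apply (proj2 (H t Ht)).
Qed.

Lemma Cderiv_Clog u t :
  (0 < Re u + t)%R -> Cderiv (fun x => Clog (u + x)) t (/ (u + t)).
Proof.
  intro H.
  assert (Hpos : forall x, (0 < Re u + x)%R -> (0 < (Re u + x) ^ 2 + Im u ^ 2)%R).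
  { intros x Hx. assert (0 < (Re u + x) ^ 2)%R by (apply pow_lt; assumption).
    assert (0 <= Im u ^ 2)%R by apply pow2_ge_0. lra. }
  assert (Hloc : locally t (fun x => (0 < Re u + x)%R)).
  { assert (Hd : (0 < Re u + t)%R) by assumption.
    exists (mkposreal _ Hd). intros x Hx.
    unfold ball in Hx. simpl in Hx. unfold AbsRing_ball, abs, minus, plus, opp in Hx.
    simpl in Hx. apply Rabs_def2 in Hx. lra. }
  assert (HRe : forall x, Re (u + RtoC x) = (Re u + x)%R) by (intro; reflexivity).
  assert (HIm : forall x, Im (u + RtoC x) = Im u)
    by (intro; simpl; unfold Im; ring).
  split.
  - apply (is_derive_ext_loc (fun x => (/ 2 * ln ((Re u + x) ^ 2 + Im u ^ 2))%R)).
    + revert Hloc. apply filter_imp. intros x Hx.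
      change (Re (Clog (u + x))) with (ln (Cmod (u + x))).
      assert (Hm : (Cmod (u + RtoC x) ^ 2 = (Re u + x) ^ 2 + Im u ^ 2)%R).
      { rewrite Cmod2_alt, HRe, HIm. reflexivity. }
      assert (Hc : (0 < Cmod (u + RtoC x))%R).
      { apply Cmod_gt_0. intro E. apply (f_equal Re) in E. rewrite HRe in E.
        simpl in E. lra. }
      rewrite <- Hm. simpl. rewrite Rmult_1_r, ln_mult by assumption. lra.
    + auto_derive; [simpl in *; specialize (Hpos t H); simpl in Hpos; lra|].
      unfold Cinv, Re, Im in *. simpl. specialize (Hpos t H). field_simplify.
      * f_equal; ring.
      * simpl in Hpos. lra.
      * simpl in Hpos. lra.
  - apply (is_derive_ext_loc (fun x => atan (Im u / (Re u + x)))).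
    + revert Hloc. apply filter_imp. intros x Hx. simpl.
      rewrite Carg_atan by now rewrite HRe. now rewrite HRe, HIm.
    + auto_derive; [lra|].
      unfold Cinv, Re, Im in *. simpl. specialize (Hpos t H). simpl in Hpos. field.
      repeat split; lra.
Qed.

Lemma is_Cseries_of_parts (a : nat -> C) (x y : R) :
  is_series (fun n => Re (a n)) x -> is_series (fun n => Im (a n)) y ->
  is_Cseries a (x, y).
Proof.
  intros Hx Hy.
  assert (Hc : forall b : nat -> R, forall z, is_series b z -> is_Cseries (fun n => RtoC (b n)) (RtoC z)).
  { intros b z Hb. apply is_Cseries_tends. intros eps He.
    assert (Hl : is_lim_seq (sum_n b) z) by exact Hb.
    apply is_lim_seq_spec in Hl. destruct (Hl (mkposreal eps He)) as [N HN].
    exists N. intros n Hn. specialize (HN n Hn). simpl in HN.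
    assert (E : Csum_n (fun k => RtoC (b k)) n = RtoC (sum_n b n) :> C).
    { clear. induction n as [|n IH]; [now rewrite !sum_O|].
      rewrite sum_n_S_C, sum_n_S_R, IH, RtoC_plus. reflexivity. }
    rewrite E, <- RtoC_minus, Cmod_R. exact HN. }
  apply is_Cseries_ext with (fun n => RtoC (Re (a n)) + Ci * RtoC (Im (a n))).
  - intro n. apply injective_projections; simpl; unfold Re, Im; ring.
  - replace (x, y) with (RtoC x + Ci * RtoC y)
      by (apply injective_projections; simpl; ring).
    apply is_Cseries_plus; [auto|]. apply is_Cseries_scal. auto.
Qed.

(** Boundedness of [|c l| rho^l] is the form in which the radius of convergence of
    the real and of the imaginary part is read off. *)
Lemma power_series_Cderiv (c : nat -> C) (rho K : R) :
  (0 < rho)%R -> (forall l, (Cmod (c l) * rho ^ l <= K)%R) ->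
  exists y y' : R -> C, forall t : R, (Rabs t < rho)%R ->
    is_Cseries (fun l => c l * RtoC t ^ l) (y t) /\
    is_Cseries (fun l => INR (S l) * c (S l) * RtoC t ^ l) (y' t) /\
    Cderiv y t (y' t).
Proof.
  intros Hrho HK.
  set (a := fun l => Re (c l)). set (b := fun l => Im (c l)).
  assert (Hcv : forall d : nat -> R, (forall l, (Rabs (d l) <= Cmod (c l))%R) ->
            forall t, (Rabs t < rho)%R -> Rbar_lt (Rabs t) (CV_radius d)).
  { intros d Hd t Ht. apply Rbar_lt_le_trans with rho; [exact Ht|].
    destruct (CV_radius_bounded d) as [Hub _]. apply Hub. exists K. intro l.
    rewrite Rabs_mult, (Rabs_pos_eq (rho ^ l)) by (apply pow_le; lra).
    apply Rle_trans with (2 := HK l). apply Rmult_le_compat_r; [apply pow_le; lra|apply Hd]. }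
  assert (Ha : forall t, (Rabs t < rho)%R -> Rbar_lt (Rabs t) (CV_radius a)).
  { apply Hcv. intro l. apply re_le_Cmod. }
  assert (Hb : forall t, (Rabs t < rho)%R -> Rbar_lt (Rabs t) (CV_radius b)).
  { apply Hcv. intro l. apply Rle_trans with (2 := Rmax_Cmod (c l)). apply Rmax_r. }
  assert (Hser : forall d : nat -> R, forall t, Rbar_lt (Rabs t) (CV_radius d) ->
             is_series (fun l => (d l * t ^ l)%R) (PSeries d t)).
  { intros d t Ht. apply is_pseries_R. apply PSeries_correct. now apply CV_radius_inside. }
  assert (Hpow : forall (t : R) l, RtoC t ^ l = RtoC (t ^ l)).
  { intros t l. symmetry. apply RtoC_pow. }
  exists (fun t => (PSeries a t, PSeries b t)),
         (fun t => (PSeries (PS_derive a) t, PSeries (PS_derive b) t)).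
  intros t Ht. specialize (Ha t Ht). specialize (Hb t Ht).
  split; [|split; [|split]].
  - apply is_Cseries_of_parts.
    + apply is_series_ext with (2 := Hser a t Ha). intro l. rewrite Hpow.
      unfold a. simpl. unfold Re. ring.
    + apply is_series_ext with (2 := Hser b t Hb). intro l. rewrite Hpow.
      unfold b. simpl. unfold Im. ring.
  - apply is_Cseries_of_parts.
    + rewrite <- CV_radius_derive in Ha.
      apply is_series_ext with (2 := Hser _ t Ha). intro l. rewrite Hpow.
      unfold a, PS_derive. cbn -[INR]. unfold Re. ring.
    + rewrite <- CV_radius_derive in Hb.
      apply is_series_ext with (2 := Hser _ t Hb). intro l. rewrite Hpow.
      unfold b, PS_derive. cbn -[INR]. unfold Im. ring.
  - now apply is_derive_PSeries.
  - now apply is_derive_PSeries.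
Qed.

Lemma is_series_exp (x : R) : is_series (fun l => (x ^ l / INR (fact l))%R) (exp x).
Proof.
  assert (H := is_exp_Reals x). apply is_pseries_R in H.
  apply is_series_ext with (2 := H). intro l. simpl. unfold Rdiv. ring.
Qed.

Lemma INR_fact_pos l : (0 < INR (fact l))%R.
Proof. apply lt_0_INR. apply lt_O_fact. Qed.

Lemma exp_partial_le x n :
  (0 <= x)%R -> (sum_n (fun l => (x ^ l / INR (fact l))%R) n <= exp x)%R.
Proof.
  intro Hx. rewrite <- (is_series_unique _ _ (is_series_exp x)).
  apply sum_n_le_Series; [|eexists; apply is_series_exp].
  intro l. apply Rmult_le_pos; [now apply pow_le|].
  left. apply Rinv_0_lt_compat, INR_fact_pos.
Qed.

Lemma Cmod_INR n : Cmod (INR n) = INR n.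
Proof. rewrite Cmod_R. apply Rabs_pos_eq, pos_INR. Qed.

(** The sum [y t] of the series at [t z] satisfies [y' = z y], so
    [y t * Cexp (- t z)] is constant. *)
Lemma is_Cseries_Cexp z : is_Cseries (fun l => z ^ l / INR (fact l)) (Cexp z).
Proof.
  set (c := fun l => z ^ l / INR (fact l)).
  assert (Hf : forall l, RtoC (INR (fact l)) <> 0)
    by (intro l; apply RtoC_neq_0, INR_fact_pos).
  assert (Hc : forall l, (Cmod (c l) * 2 ^ l <= exp (Cmod z * 2))%R).
  { intro l. unfold c. rewrite Cmod_div, Cmod_pow, Cmod_INR by auto.
    assert (Hn : (0 <= Cmod z * 2)%R) by (assert (H := Cmod_ge_0 z); lra).
    assert (Hpos : forall k, (0 <= (Cmod z * 2) ^ k / INR (fact k))%R).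
    { intro k. apply Rmult_le_pos; [now apply pow_le|].
      left. apply Rinv_0_lt_compat, INR_fact_pos. }
    apply Rle_trans with (2 := exp_partial_le _ l Hn).
    replace (Cmod z ^ l / INR (fact l) * 2 ^ l)%R with ((Cmod z * 2) ^ l / INR (fact l))%R.
    - exact (term_le_sum_n _ l Hpos).
    - rewrite Rpow_mult_distr. field. assert (H := INR_fact_pos l). lra. }
  destruct (power_series_Cderiv c 2 _ ltac:(lra) Hc) as [y [y' Hy]].
  assert (Hode : forall t, (0 <= t <= 1)%R -> y' t = z * y t).
  { intros t Ht. destruct (Hy t ltac:(rewrite Rabs_pos_eq; lra)) as [H1 [H2 _]].
    apply (is_Cseries_unique _ _ _ H2).
    apply is_Cseries_ext with (2 := is_Cseries_scal z _ _ H1).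
    intro l. unfold c. rewrite fact_simpl, mult_INR, RtoC_mult. cbn -[INR fact].
    field. split; [apply Hf|]. apply RtoC_neq_0, lt_0_INR. lia. }
  assert (E := Cderiv_zero_const (fun t => y t * Cexp (- z * RtoC t))).
  assert (E1 : y 1%R * Cexp (- z * 1) = y 0%R * Cexp (- z * 0)).
  { apply E. intros t Ht.
    apply Cderiv_eq with (1 := Cderiv_mult _ _ _ _ _
       (proj2 (proj2 (Hy t ltac:(rewrite Rabs_pos_eq; lra))))
       (Cderiv_Cexp _ _ _ (Cderiv_scal RtoC t 1 (- z) (Cderiv_RtoC t)))).
    rewrite Hode by assumption. ring. }
  assert (Hy0 : y 0%R = 1).
  { destruct (Hy 0%R ltac:(rewrite Rabs_R0; lra)) as [H0 _].
    apply (is_Cseries_unique _ _ _ H0).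
    apply is_Cseries_cons. unfold c at 2.
    replace (1 - z ^ 0 / INR (fact 0) * 0 ^ 0) with (RtoC 0)
      by (simpl; field; intro E2; apply (f_equal fst) in E2; simpl in E2; lra).
    apply is_Cseries_ext with (2 := is_Cseries_zero). intro l. simpl. ring. }
  rewrite Hy0 in E1. replace (- z * 0) with (RtoC 0) in E1 by ring.
  replace (- z * 1) with (- z) in E1 by ring. rewrite Cexp_0, Cexp_opp in E1.
  assert (Hz := Cexp_neq_0 z).
  replace (Cexp z) with (y 1%R).
  - destruct (Hy 1%R ltac:(rewrite Rabs_R1; lra)) as [H1 _].
    apply is_Cseries_ext with (2 := H1). intro l. rewrite Cpow_1_l. ring.
  - replace (y 1%R) with (y 1%R * / Cexp z * Cexp z) by (field; assumption).
    rewrite E1. ring.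
Qed.

(** Factoring out [Cexp (s0 * a)] leaves the exponential series in
    [(s - s0) * a]. *)
Lemma wiener_Cexp s0 r a :
  (0 <= r)%R ->
  wiener s0 r (exp (Re (s0 * a)) * exp (Cmod a * r))%R (fun s => Cexp (s * a)).
Proof.
  intro Hr. rewrite <- Cmod_Cexp.
  apply wiener_ext with (fun s => Cexp (s0 * a) * Cexp ((s - s0) * a)).
  { intros s _. rewrite <- Cexp_plus. f_equal. ring. }
  apply wiener_scal.
  exists (fun l => a ^ l / INR (fact l)). split.
  - intro n.
    apply Rle_trans with (2 := exp_partial_le (Cmod a * r) n
       ltac:(apply Rmult_le_pos; [apply Cmod_ge_0|assumption])).
    right. apply sum_n_ext_R. intro l.
    rewrite Cmod_div, Cmod_pow, Cmod_INR by (apply RtoC_neq_0, INR_fact_pos).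
    rewrite Rpow_mult_distr. unfold Rdiv. ring.
  - intros s _. apply is_Cseries_ext with (2 := is_Cseries_Cexp ((s - s0) * a)).
    intro l. rewrite Cpow_mult_l. unfold Cdiv. ring.
Qed.

(** * The binomial series *)

Fixpoint Cbinom (w : C) (l : nat) : C :=
  match l with
  | O => 1
  | S k => Cbinom w k * (w - INR k) / INR (S k)
  end.

(** [|binomial (-x, l)|] for positive [x]: the majorant of [Cbinom w l] over
    [|w| <= x]. *)
Fixpoint rising (x : R) (l : nat) : R :=
  match l with
  | O => 1
  | S k => rising x k * (x + INR k) / INR (S k)
  end.

Lemma rising_pos x l : (0 < x)%R -> (0 < rising x l)%R.
Proof.
  intro Hx. induction l as [|l IH]; [simpl; lra|].
  cbn -[INR]. apply Rdiv_lt_0_compat; [|apply lt_0_INR; lia].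
  apply Rmult_lt_0_compat; [assumption|]. assert (H := pos_INR l). lra.
Qed.

Lemma Cmod_Cbinom_le w x l : (Cmod w <= x)%R -> (Cmod (Cbinom w l) <= rising x l)%R.
Proof.
  intro Hw. induction l as [|l IH].
  - simpl. rewrite Cmod_1. lra.
  - cbn -[INR].
    assert (Hl : (0 < INR (S l))%R) by (apply lt_0_INR; lia).
    rewrite Cmod_div, Cmod_mult, Cmod_INR by now apply RtoC_neq_0.
    apply Rmult_le_compat_r; [left; now apply Rinv_0_lt_compat|].
    apply Rmult_le_compat; try apply Cmod_ge_0; [assumption|].
    unfold Cminus. apply Rle_trans with (1 := Cmod_triangle _ _).
    rewrite Cmod_opp, Cmod_INR. lra.
Qed.

Lemma ex_series_rising x q :
  (0 < x)%R -> (0 < q < 1)%R -> ex_series (fun l => (rising x l * q ^ l)%R).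
Proof.
  intros Hx Hq.
  assert (Hpos : forall l, (0 < rising x l * q ^ l)%R).
  { intro l. apply Rmult_lt_0_compat; [now apply rising_pos|apply pow_lt; lra]. }
  apply ex_series_ext with (fun l => Rabs (rising x l * q ^ l)).
  { intro l. rewrite Rabs_pos_eq; [reflexivity|]. left. apply Hpos. }
  apply ex_series_DAlembert with q; [lra| |].
  { intro l. specialize (Hpos l). lra. }
  apply is_lim_seq_ext with (fun l => (q * (1 + (x - 1) * / INR (S l)))%R).
  - intro l. specialize (Hpos l) as H1. assert (Hr := rising_pos x l Hx).
    assert (Hl : (0 < INR (S l))%R) by (apply lt_0_INR; lia).
    assert (Hql : (0 < q ^ l)%R) by (apply pow_lt; lra).
    assert (Hl0 := pos_INR l).
    rewrite Rabs_pos_eq.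
    + cbn -[INR]. rewrite S_INR in *. field. repeat split; lra.
    + left. apply Rdiv_lt_0_compat; apply Hpos.
  - replace (Finite q) with (Finite (q * (1 + (x - 1) * 0))%R) by (f_equal; ring).
    assert (Hinv : is_lim_seq (fun l => / INR (S l))%R 0%R).
    { apply (is_lim_seq_incr_1 (fun l => / INR l)%R).
      apply (is_lim_seq_inv INR p_infty); [apply is_lim_seq_INR|discriminate]. }
    apply (is_lim_seq_scal_l _ q (1 + (x - 1) * 0)%R).
    apply is_lim_seq_plus'; [apply is_lim_seq_const|].
    now apply (is_lim_seq_scal_l _ (x - 1) 0%R).
Qed.

(** In the norm, as for numbers, [f - k] is at most [M + k]. *)
Lemma wiener_Cbinom s0 r M f l :
  (0 < r)%R -> wiener s0 r M f -> wiener s0 r (rising M l) (fun s => Cbinom (f s) l).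
Proof.
  intros Hr Hf. induction l as [|l IH].
  - exact (eq_ind _ (fun x => wiener s0 r x (fun _ => 1)) (wiener_const s0 r 1) _ Cmod_1).
  - assert (Hl : (0 < INR (S l))%R) by (apply lt_0_INR; lia).
    cbn -[INR].
    apply wiener_ext with (fun s => / INR (S l) * (Cbinom (f s) l * (f s + - INR l))).
    { intros s _. field. now apply RtoC_neq_0. }
    replace (rising M l * (M + INR l) / INR (S l))%R
      with (Cmod (/ INR (S l)) * (rising M l * (M + Cmod (- INR l))))%R.
    + apply wiener_scal. apply wiener_mult; [assumption|assumption|].
      apply wiener_plus; [lra|assumption|apply wiener_const].
    + rewrite Cmod_inv, Cmod_opp, !Cmod_INR by now apply RtoC_neq_0. field. lra.
Qed.

(** The sum [y t] of [Cbinom w l * (t / u)^l] satisfies [(u + t) y' = w y], the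
    equation of [(u + t)^w], so [y t * Cexp (- w * Clog (u + t))] is constant.
    Following [Clog] along [u + t] avoids adding principal arguments. *)
Lemma Cbinom_series w u :
  (0 < Re u)%R -> (2 <= Cmod u)%R ->
  is_Cseries (fun l => Cbinom w l * Cpower u (w - INR l)) (Cpower (u + 1) w).
Proof.
  intros Hu Hu2.
  assert (Hu0 : u <> 0) by (intros ->; rewrite Cmod_0 in Hu2; lra).
  set (c := fun l => Cbinom w l * (/ u) ^ l).
  assert (Hx : (0 < Cmod w + 1)%R) by (assert (H := Cmod_ge_0 w); lra).
  assert (Hinv : (0 <= Cmod (/ u) <= / 2)%R).
  { split; [apply Cmod_ge_0|]. rewrite Cmod_inv by assumption.
    apply Rinv_le_contravar; lra. }
  (* Any radius between [1] and [|u|] will do, since [t] runs up to [1]; at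
     [3 / 2] the terms are at most [rising x l * (3 / 4)^l]. *)
  assert (Hc : exists K, forall l, (Cmod (c l) * (3 / 2) ^ l <= K)%R).
  { exists (Series (fun l => (rising (Cmod w + 1) l * (3 / 4) ^ l)%R)). intro l.
    assert (Hpos : forall k, (0 <= rising (Cmod w + 1) k * (3 / 4) ^ k)%R).
    { intro k. apply Rmult_le_pos; [left; now apply rising_pos|apply pow_le; lra]. }
    assert (Hle := sum_n_le_Series _ l Hpos (ex_series_rising _ (3 / 4) Hx ltac:(lra))).
    apply Rle_trans with (2 := Hle).
    apply Rle_trans with (rising (Cmod w + 1) l * (3 / 4) ^ l)%R.
    - unfold c. rewrite Cmod_mult, Cmod_pow.
      replace (3 / 4)%R with (/ 2 * (3 / 2))%R by field.
      rewrite Rpow_mult_distr, <- Rmult_assoc.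
      apply Rmult_le_compat_r; [apply pow_le; lra|].
      apply Rmult_le_compat; [apply Cmod_ge_0|apply pow_le, Cmod_ge_0| |].
      + apply Cmod_Cbinom_le. lra.
      + now apply pow_incr.
    - exact (term_le_sum_n _ l Hpos). }
  destruct Hc as [K HK].
  destruct (power_series_Cderiv c (3 / 2) K ltac:(lra) HK) as [y [y' Hy]].
  assert (Hut : forall t, (0 <= t)%R -> u + RtoC t <> 0).
  { intros t Ht E. apply (f_equal fst) in E. simpl in E. unfold Re in Hu. lra. }
  assert (Hode : forall t, (0 <= t <= 1)%R -> (u + t) * y' t = w * y t).
  { intros t Ht. destruct (Hy t ltac:(rewrite Rabs_pos_eq; lra)) as [H1 [H2 _]].
    assert (H3 : is_Cseries (fun l => INR l * c l * RtoC t ^ l) (t * y' t)).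
    { apply is_Cseries_cons.
      replace (t * y' t - INR 0 * c 0%nat * t ^ 0) with (t * y' t) by (simpl; ring).
      apply is_Cseries_ext with (2 := is_Cseries_scal t _ _ H2).
      intro l. cbn -[INR c]. ring. }
    assert (H4 := is_Cseries_plus _ _ _ _ (is_Cseries_scal u _ _ H2) H3).
    replace ((u + t) * y' t) with (u * y' t + t * y' t) by ring.
    apply (is_Cseries_unique _ _ _ H4).
    apply is_Cseries_ext with (2 := is_Cseries_scal w _ _ H1).
    intro l. unfold c. cbn -[INR]. field. split; [assumption|]. apply RtoC_neq_0, lt_0_INR. lia. }
  assert (E1 : y 1%R * Cexp (- w * Clog (u + 1)) = y 0%R * Cexp (- w * Clog (u + 0))).
  { apply (Cderiv_zero_const (fun t => y t * Cexp (- w * Clog (u + RtoC t)))).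
    intros t Ht.
    apply Cderiv_eq with (1 := Cderiv_mult _ _ _ _ _
       (proj2 (proj2 (Hy t ltac:(rewrite Rabs_pos_eq; lra))))
       (Cderiv_Cexp _ _ _ (Cderiv_scal _ t _ (- w) (Cderiv_Clog u t ltac:(lra))))).
    specialize (Hode t Ht). specialize (Hut t ltac:(lra)).
    replace (y' t) with (w * y t / (u + t)).
    - field. assumption.
    - rewrite <- Hode. field. assumption. }
  assert (Hy0 : y 0%R = 1).
  { destruct (Hy 0%R ltac:(rewrite Rabs_R0; lra)) as [H0 _].
    apply (is_Cseries_unique _ _ _ H0).
    apply is_Cseries_cons. unfold c at 2. simpl.
    replace (1 - 1 * 1 * 1) with (RtoC 0) by ring.
    apply is_Cseries_ext with (2 := is_Cseries_zero). intro l. simpl. ring. }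
  rewrite Hy0, Cplus_0_r in E1.
  replace (- w * Clog (u + 1)) with (- (w * Clog (u + 1))) in E1 by ring.
  replace (- w * Clog u) with (- (w * Clog u)) in E1 by ring.
  rewrite !Cexp_opp in E1.
  assert (Hu1 := Hut 1%R ltac:(lra)).
  rewrite <- !Cpower_Cexp in E1 by assumption.
  assert (Hp : Cpower u w <> 0) by (rewrite Cpower_Cexp by assumption; apply Cexp_neq_0).
  assert (Hp1 : Cpower (u + 1) w <> 0) by (rewrite Cpower_Cexp by assumption; apply Cexp_neq_0).
  replace (Cpower (u + 1) w) with (Cpower u w * y 1%R).
  - destruct (Hy 1%R ltac:(rewrite Rabs_R1; lra)) as [H1 _].
    apply is_Cseries_ext with (2 := is_Cseries_scal (Cpower u w) _ _ H1).
    intro l. unfold Cminus. rewrite Cpower_plus, Cpower_opp, Cpower_INR by assumption.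
    unfold c. rewrite Cpow_1_l, Cpow_inv by assumption. ring.
  - replace (y 1%R) with (y 1%R * / Cpower (u + 1) w * Cpower (u + 1) w)
      by (field; assumption).
    rewrite E1. field. assumption.
Qed.

(** * Continuation to the left by a functional equation *)

Lemma is_Cseries_drop (a : nat -> C) (l : C) n :
  is_Cseries a l <-> is_Cseries (fun k => a (S n + k)%nat) (l - Csum_n a n).
Proof.
  induction n as [|n IH].
  - rewrite sum_O. apply is_Cseries_cons.
  - rewrite IH, (is_Cseries_cons (fun k => a (S n + k)%nat)).
    rewrite sum_n_S_C, Nat.add_0_r.
    replace (l - (Csum_n a n + a (S n))) with (l - Csum_n a n - a (S n)) by ring.
    split; apply is_Cseries_ext; intro k; f_equal; lia.
Qed.

(** Go back to [q] from a point of the ray so far away that its real part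
    exceeds [1]. *)
Lemma zero_of_zero_far_right f (q dir : C) :
  (0 < Re dir)%R ->
  (forall x : R, (0 <= x)%R -> analytic_at f (q + RtoC x * dir)) ->
  (forall s, (1 < Re s)%R -> f s = 0) -> f q = 0.
Proof.
  intros Hdir Han Hf.
  set (x0 := ((Rabs (Re q) + 2) / Re dir)%R).
  assert (Hx0 : (0 <= x0)%R).
  { left. apply Rdiv_lt_0_compat; [|assumption]. assert (H := Rabs_pos (Re q)). lra. }
  apply (vanishes_along_segment f (q + x0 * dir)).
  - intros t Ht.
    replace (q + x0 * dir + t * (q - (q + x0 * dir))) with (q + RtoC ((1 - t) * x0) * dir)
      by (rewrite RtoC_mult, RtoC_minus; ring).
    apply Han. apply Rmult_le_pos; lra.
  - exists 1%R. split; [lra|]. intros s Hs. apply Hf.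
    assert (H1 : (Re (q + x0 * dir) = Re q + (Rabs (Re q) + 2))%R).
    { replace (Re (q + x0 * dir)) with (Re q + x0 * Re dir)%R
        by (unfold Re; simpl; ring).
      unfold x0. field. lra. }
    assert (H2 := re_le_Cmod (s - (q + x0 * dir))).
    assert (H3 : Re (s - (q + x0 * dir)) = (Re s - Re (q + x0 * dir))%R)
      by (unfold Re; simpl; ring).
    rewrite H3, H1 in H2. assert (H4 := Rle_abs (- Re q)). rewrite Rabs_Ropp in H4.
    apply Rabs_le_between in H2. lra.
Qed.

Lemma Re_plus_R (s : C) (x : R) : Re (s + RtoC x) = (Re s + x)%R.
Proof. reflexivity. Qed.

Lemma Re_close (s s0 : C) r : (Cmod (s - s0) < r)%R -> (Re s0 - r < Re s < Re s0 + r)%R.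
Proof.
  intro H. assert (H2 := re_le_Cmod (s - s0)).
  assert (H3 : Re (s - s0) = (Re s - Re s0)%R) by (unfold Re; simpl; ring).
  rewrite H3 in H2. apply Rabs_le_between in H2. lra.
Qed.

Lemma nat_above (x : R) : exists n : nat, (x < INR n)%R.
Proof.
  destruct (archimed_cor1 (/ (Rabs x + 1))%R) as [n [Hn Hn0]].
  { apply Rinv_0_lt_compat. assert (H := Rabs_pos x). lra. }
  exists n. assert (H := Rabs_pos x). assert (H1 := Rle_abs x).
  assert (Hn' : (0 < INR n)%R) by (apply lt_0_INR; lia).
  apply Rinv_lt_cancel in Hn; lra.
Qed.

(** For [Re s > -N] every [s + l] with [l >= 1] has real part larger than [1 - N],
    so [b + sum_l q_l * F (. + l)] makes sense; it is analytic because beyond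
    some index [F] may be replaced by [G] and the norms are summable. *)
Lemma continuation_step (q : nat -> C -> C) (b G F : C -> C) (N : nat) :
  (forall l s0, analytic_at (q l) s0) ->
  (forall s0, analytic_at b s0) ->
  (forall s0, exists r l0 (M : nat -> R), (0 < r)%R /\ ex_series M /\
     forall l, (l0 <= l)%nat ->
       wiener s0 r (M l) (fun s => q l s * G (s + INR (S l)))) ->
  (forall s, (1 < Re s)%R ->
     is_Cseries (fun l => q l s * G (s + INR (S l))) (G s - b s)) ->
  (forall s0, (1 - INR N < Re s0)%R -> analytic_at F s0) ->
  (forall s, (1 < Re s)%R -> F s = G s) ->
  exists F' : C -> C,
    (forall s0, (1 - INR (S N) < Re s0)%R -> analytic_at F' s0) /\
    (forall s, (1 < Re s)%R -> F' s = G s).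
Proof.
  intros Hq Hb Htail Heq HF HFG.
  assert (HFGl : forall s l, (1 < Re s + INR (S l))%R -> F (s + INR (S l)) = G (s + INR (S l))).
  { intros s l H. apply HFG. now rewrite Re_plus_R. }
  (* On a disc around [s0] the tail from index [L + 1] on only involves [G]. *)
  assert (Hloc : forall s0, exists r L (M : nat -> R), (0 < r)%R /\ ex_series M /\
     (forall k, wiener s0 r (M k)
        (fun s => q (S L + k)%nat s * F (s + INR (S (S L + k)))))).
  { intro s0. destruct (Htail s0) as [r [l0 [M [Hr [HM HW]]]]].
    destruct (nat_above (1 - Re s0 + r)%R) as [L HL].
    exists r, (l0 + L)%nat, (fun k => M (S (l0 + L) + k)%nat). split; [assumption|].
    split.
    - apply (ex_series_incr_n (K := R_AbsRing) (V := R_NormedModule) M). assumption.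
    - intro k.
      apply wiener_ext with (2 := HW (S (l0 + L) + k)%nat ltac:(lia)).
      intros s Hs. rewrite HFGl; [reflexivity|].
      apply Re_close in Hs.
      assert (HLl : (INR L <= INR (S (S (l0 + L) + k)))%R) by (apply le_INR; lia). lra. }
  assert (Hex : forall s, exists w : C, is_Cseries (fun l => q l s * F (s + INR (S l))) w).
  { intro s. destruct (Hloc s) as [r [L [M [Hr [HM HW]]]]].
    destruct (ex_Cseries_le (fun k => q (S L + k)%nat s * F (s + INR (S (S L + k)))) M)
      as [w Hw]; [|assumption|].
    - intro k. destruct (HW k) as [c [Hc Hs]].
      assert (H0 : (Cmod (s - s) < r)%R)
        by (replace (s - s) with (RtoC 0) by ring; now rewrite Cmod_0).
      apply (is_Cseries_norm_le _ _ _ (Hs s H0)). intro n.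
      apply Rle_trans with (2 := Hc n). apply sum_n_le_R. intro l.
      rewrite Cmod_mult, Cmod_pow. apply Rmult_le_compat_l; [apply Cmod_ge_0|].
      apply pow_incr. split; [apply Cmod_ge_0|lra].
    - exists (w + Csum_n (fun l => q l s * F (s + INR (S l))) L).
      apply (is_Cseries_drop _ _ L).
      replace (w + Csum_n (fun l => q l s * F (s + INR (S l))) L
               - Csum_n (fun l => q l s * F (s + INR (S l))) L) with w by ring.
      exact Hw. }
  destruct (functional_choice _ Hex) as [T HT].
  exists (fun s => b s + T s). split.
  - intros s0 Hs0.
    destruct (Hloc s0) as [r [L [M [Hr [HM HW]]]]].
    apply analytic_at_ext with
      (fun s => b s + (Csum_n (fun l => q l s * F (s + INR (S l))) L
                       + (T s - Csum_n (fun l => q l s * F (s + INR (S l))) L))) 1%R.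
    { lra. }
    { intros s _. ring. }
    apply analytic_at_plus; [apply Hb|]. apply analytic_at_plus.
    + apply analytic_at_sum_n. intros l _. apply analytic_at_mult; [apply Hq|].
      apply analytic_at_translate. apply HF. rewrite Re_plus_R.
      rewrite S_INR in *. assert (H := pos_INR l). lra.
    + exists r, (Series M). split; [assumption|].
      apply wiener_series with
        (f := fun k s => q (S L + k)%nat s * F (s + INR (S (S L + k)))); auto.
      intros s _. exact (proj1 (is_Cseries_drop _ _ L) (HT s)).
  - intros s Hs.
    assert (E : T s = G s - b s).
    { apply (is_Cseries_unique _ _ _ (HT s)).
      apply is_Cseries_ext with (2 := Heq s Hs). intro l. rewrite HFGl; [reflexivity|].
      assert (H := pos_INR (S l)). lra. }
    rewrite E. ring.
Qed.

(** The extensions to the half-planes [Re s > 1 - N] agree where two of them are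
    defined, by the identity theorem, hence glue. *)
Lemma entire_continuation (q : nat -> C -> C) (b G : C -> C) :
  (forall l s0, analytic_at (q l) s0) ->
  (forall s0, analytic_at b s0) ->
  (forall s0, (1 < Re s0)%R -> analytic_at G s0) ->
  (forall s0, exists r l0 (M : nat -> R), (0 < r)%R /\ ex_series M /\
     forall l, (l0 <= l)%nat ->
       wiener s0 r (M l) (fun s => q l s * G (s + INR (S l)))) ->
  (forall s, (1 < Re s)%R ->
     is_Cseries (fun l => q l s * G (s + INR (S l))) (G s - b s)) ->
  exists F : C -> C,
    (forall s0, analytic_at F s0) /\ (forall s, (1 < Re s)%R -> F s = G s).
Proof.
  intros Hq Hb HG Htail Heq.
  assert (Hstrip : forall N : nat, exists F : C -> C,
    (forall s0, (1 - INR N < Re s0)%R -> analytic_at F s0) /\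
    (forall s, (1 < Re s)%R -> F s = G s)).
  { induction N as [|N [F [H1 H2]]].
    - exists G. split; [|reflexivity]. intros s0 Hs0. apply HG. simpl in Hs0. lra.
    - exact (continuation_step q b G F N Hq Hb Htail Heq H1 H2). }
  destruct (functional_choice _ Hstrip) as [F HF].
  destruct (functional_choice (fun (s : C) n => (1 - Re s < INR n)%R)) as [N HN].
  { intro s. apply nat_above. }
  assert (Hagree : forall n n' s, (1 - INR n < Re s)%R -> (1 - INR n' < Re s)%R ->
            F n s = F n' s).
  { intros n n' s Hn Hn'.
    assert (E : F n s - F n' s = 0).
    { apply (zero_of_zero_far_right (fun s => F n s - F n' s) s 1).
      - simpl. lra.
      - intros x Hx. rewrite Cmult_1_r.
        apply analytic_at_minus; apply HF; rewrite Re_plus_R; lra.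
      - intros s' Hs'. rewrite (proj2 (HF n)), (proj2 (HF n')) by assumption. ring. }
    replace (F n s) with (F n s - F n' s + F n' s) by ring. rewrite E. ring. }
  exists (fun s => F (N s) s). split.
  - intro s0. apply analytic_at_ext with (F (S (N s0))) 1%R; [lra| |].
    + intros s Hs. apply Re_close in Hs. apply Hagree.
      * specialize (HN s0). rewrite S_INR. lra.
      * specialize (HN s). lra.
    + apply HF. specialize (HN s0). rewrite S_INR. lra.
  - intros s Hs. now apply HF.
Qed.

(** * Estimates for the Lerch series *)

(** Comparison with the telescoping sum of [x^(1-sigma) / (sigma-1)]. *)
Lemma ex_series_Rpower sigma :
  (1 < sigma)%R -> ex_series (fun j => Rpower (INR j + 2) (- sigma)).
Proof.
  intro Hs.
  set (g := fun x => (Rpower x (1 - sigma) / (sigma - 1))%R).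
  assert (Hder : forall y, (0 < y)%R -> is_derive g y (- Rpower y (- sigma))%R).
  { intros y Hy. apply is_derive_Reals.
    replace (- Rpower y (- sigma))%R
      with ((1 - sigma) * Rpower y (1 - sigma - 1) * / (sigma - 1))%R.
    - apply (derivable_pt_lim_scal_right (fun x => Rpower x (1 - sigma))).
      now apply derivable_pt_lim_power.
    - replace (1 - sigma - 1)%R with (- sigma)%R by ring. field. lra. }
  assert (Hstep : forall x, (1 <= x)%R -> (Rpower (x + 1) (- sigma) <= g x - g (x + 1))%R).
  { intros x Hx.
    destruct (MVT_gen g x (x + 1) (fun y => - Rpower y (- sigma))%R) as [c [Hc E]].
    - intros y Hy. rewrite Rmin_left, Rmax_right in Hy by lra.
      apply Hder. lra.
    - intros y Hy. rewrite Rmin_left, Rmax_right in Hy by lra.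
      apply continuity_pt_filterlim.
      apply (ex_derive_continuous (K := R_AbsRing) (V := R_NormedModule)).
      eexists. apply Hder. lra.
    - rewrite Rmin_left, Rmax_right in Hc by lra.
      assert (Hmono : (Rpower (x + 1) (- sigma) <= Rpower c (- sigma))%R).
      { rewrite !Rpower_Ropp. apply Rinv_le_contravar; [apply exp_pos|].
        apply Rle_Rpower_l; lra. }
      lra. }
  apply ex_series_bounded with (g 1%R).
  - intro k. left. apply exp_pos.
  - assert (Hn : forall n, (sum_n (fun j => Rpower (INR j + 2) (- sigma)) n
                            <= g 1 - g (INR n + 2))%R).
    { induction n as [|n IH].
      - rewrite sum_O. simpl INR. rewrite Rplus_0_l.
        apply (Hstep 1%R). lra.
      - rewrite sum_n_S_R. assert (H := pos_INR n).
        specialize (Hstep (INR n + 2)%R ltac:(lra)).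
        rewrite S_INR.
        replace (INR n + 1 + 2)%R with (INR n + 2 + 1)%R by ring. lra. }
    intro n. specialize (Hn n).
    assert (Hg : (0 < g (INR n + 2))%R).
    { unfold g. apply Rdiv_lt_0_compat; [apply exp_pos|lra]. }
    lra.
Qed.

Lemma exp_monotone (x y : R) : (x <= y)%R -> (exp x <= exp y)%R.
Proof. intros [H| ->]; [left; now apply exp_increasing|lra]. Qed.

Lemma ln_nonneg x : (1 <= x)%R -> (0 <= ln x)%R.
Proof. intro H. rewrite <- ln_1. apply ln_le; lra. Qed.

Lemma Cmod_Clog_le (u : C) : (1 <= Cmod u)%R -> (Cmod (Clog u) <= ln (Cmod u) + PI)%R.
Proof.
  intro Hu. unfold Clog.
  replace (ln (Cmod u), Carg u) with (RtoC (ln (Cmod u)) + Ci * RtoC (Carg u))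
    by (apply injective_projections; simpl; ring).
  apply Rle_trans with (1 := Cmod_triangle _ _).
  rewrite Cmod_mult, Cmod_Ci, !Cmod_R, (Rabs_pos_eq (ln _)) by now apply ln_nonneg.
  assert (H := Carg_bound u). lra.
Qed.

(** The norm of [s |-> |u|^(-s)] on a disc is its largest value there; the
    exponential factor again pays for the argument of [u]. *)
Lemma wiener_Cpower s0 r u :
  (0 <= r)%R -> (1 <= Cmod u)%R ->
  wiener s0 r (exp (PI * (Rabs (Im s0) + r)) * Rpower (Cmod u) (- (Re s0 - r)))%R
    (fun s => Cpower u (- s)).
Proof.
  intros Hr Hu.
  assert (Hu0 : u <> 0) by (intros ->; rewrite Cmod_0 in Hu; lra).
  apply wiener_ext with (fun s => Cexp (s * (- Clog u))).
  { intros s _. rewrite Cpower_Cexp by assumption. f_equal. ring. }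
  apply wiener_weaken with (3 := wiener_Cexp s0 r (- Clog u) Hr); [lra|].
  unfold Rpower. rewrite <- !exp_plus. apply exp_monotone.
  rewrite Cmod_opp.
  assert (E : Re (s0 * - Clog u) = (- (Re s0 * ln (Cmod u)) + Im s0 * Carg u)%R)
    by (unfold Re, Im; simpl; ring).
  rewrite E. assert (Hl := Cmod_Clog_le u Hu).
  assert (Hi : (Im s0 * Carg u <= Rabs (Im s0) * PI)%R).
  { apply Rle_trans with (1 := Rle_abs _). rewrite Rabs_mult.
    apply Rmult_le_compat_l; [apply Rabs_pos|apply Carg_bound]. }
  apply (Rmult_le_compat_r r) in Hl; [|assumption]. lra.
Qed.

Lemma Rpower_shift_le x sigma l :
  (2 <= x)%R -> (Rpower x (- (sigma + INR l)) <= (/ 2) ^ l * Rpower x (- sigma))%R.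
Proof.
  intro Hx.
  replace (- (sigma + INR l))%R with (- INR l + - sigma)%R by ring.
  rewrite Rpower_plus. apply Rmult_le_compat_r; [left; apply exp_pos|].
  rewrite Rpower_Ropp, Rpower_pow, <- pow_inv by lra.
  apply pow_incr. split.
  - left. apply Rinv_0_lt_compat. lra.
  - apply Rinv_le_contravar; lra.
Qed.

Lemma Rpower_anti x y sigma :
  (0 < x <= y)%R -> (0 <= sigma)%R -> (Rpower y (- sigma) <= Rpower x (- sigma))%R.
Proof.
  intros Hxy Hs. rewrite !Rpower_Ropp. apply Rinv_le_contravar; [apply exp_pos|].
  now apply Rle_Rpower_l.
Qed.

Lemma Cmod_shift_ge (v : C) j : (2 <= Re v)%R -> (INR j + 2 <= Cmod (v + INR j))%R.
Proof.
  intro Hv. assert (H := re_le_Cmod (v + INR j)). rewrite Re_plus_R in H.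
  assert (H1 := Rle_abs (Re v + INR j)). lra.
Qed.

Lemma Cmod_shift_ge_2 (v : C) j : (2 <= Re v)%R -> (2 <= Cmod (v + INR j))%R.
Proof.
  intro Hv. assert (H := Cmod_shift_ge v j Hv). assert (H1 := pos_INR j). lra.
Qed.

Lemma Cmod_pow_le_1 (z : C) j : (Cmod z <= 1)%R -> (Cmod (z ^ j) <= 1)%R.
Proof.
  intro Hz. rewrite Cmod_pow, <- (pow1 j). apply pow_incr.
  split; [apply Cmod_ge_0|assumption].
Qed.

(** The decay [2^(-l)] comes from [|v + j| >= 2], which is why [Re v >= 2] is
    arranged first. *)
Lemma wiener_lerch (z v : C) (Phi : C -> C) s0 r :
  (Cmod z <= 1)%R -> (2 <= Re v)%R -> (0 < r)%R -> (1 < Re s0 - r)%R ->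
  (forall s, (1 < Re s)%R -> is_lerch_series z s v (Phi s)) ->
  forall l : nat,
  wiener s0 r ((/ 2) ^ l * (exp (PI * (Rabs (Im s0) + r)) *
                 Series (fun j => Rpower (INR j + 2) (- (Re s0 - r)))))%R
    (fun s => Phi (s + INR l)).
Proof.
  intros Hz Hv Hr Hs0 HPhi l.
  set (A := exp (PI * (Rabs (Im s0) + r))).
  assert (HA : (0 < A)%R) by apply exp_pos.
  apply wiener_translate.
  replace ((/ 2) ^ l * (A * Series (fun j => Rpower (INR j + 2) (- (Re s0 - r)))))%R
    with (Series (fun j => (/ 2) ^ l * A * Rpower (INR j + 2) (- (Re s0 - r)))%R)
    by (rewrite Series_scal_l; ring).
  apply wiener_series with (f := fun j s => lerch_term z s v j); [assumption| | |].
  - apply (ex_series_scal_l (K := R_AbsRing) (V := R_NormedModule)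
             ((/ 2) ^ l * A)%R (fun j => Rpower (INR j + 2) (- (Re s0 - r)))).
    now apply ex_series_Rpower.
  - intro j. unfold lerch_term.
    assert (Hu := Cmod_shift_ge v j Hv). assert (Hu2 := Cmod_shift_ge_2 v j Hv).
    assert (Hj := pos_INR j).
    apply wiener_ext with (fun s => z ^ j * Cpower (v + INR j) (- s)).
    { intros s _. ring. }
    apply wiener_weaken with
      (3 := wiener_scal _ _ _ _ (z ^ j) (wiener_Cpower (s0 + INR l) r (v + INR j)
              ltac:(lra) ltac:(lra))); [lra|].
    replace (Im (s0 + INR l)) with (Im s0) by (unfold Im; simpl; ring). fold A.
    rewrite Re_plus_R.
    replace (Re s0 + INR l - r)%R with (Re s0 - r + INR l)%R by ring.
    assert (H1 := Rpower_shift_le (Cmod (v + INR j)) (Re s0 - r) l Hu2).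
    assert (H2 := Rpower_anti (INR j + 2) (Cmod (v + INR j)) (Re s0 - r) ltac:(lra) ltac:(lra)).
    assert (H3 := Cmod_pow_le_1 z j Hz).
    assert (H4 : (0 < Rpower (Cmod (v + INR j)) (- (Re s0 - r + INR l)))%R) by apply exp_pos.
    assert (Hl : (0 < (/ 2) ^ l)%R) by (apply pow_lt; lra).
    apply Rle_trans with (1 * (A * Rpower (Cmod (v + INR j)) (- (Re s0 - r + INR l))))%R.
    + apply Rmult_le_compat_r; [|assumption]. apply Rmult_le_pos; lra.
    + rewrite Rmult_1_l, (Rmult_comm ((/ 2) ^ l)), Rmult_assoc.
      apply Rmult_le_compat_l; [lra|]. apply Rle_trans with (1 := H1).
      apply Rmult_le_compat_l; lra.
  - intros s Hs. apply HPhi. apply Re_close in Hs. rewrite Re_plus_R in Hs.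
    assert (Hl := pos_INR l). lra.
Qed.

Lemma ex_lerch_right (z v : C) s :
  (Cmod z <= 1)%R -> (2 <= Re v)%R -> (1 < Re s)%R ->
  exists w, is_lerch_series z s v w.
Proof.
  intros Hz Hv Hs.
  apply ex_Cseries_le with
    (fun j => (exp (PI * Rabs (Im s)) * Rpower (INR j + 2) (- Re s))%R).
  - intro j. unfold lerch_term. rewrite Cmod_mult.
    assert (Hu := Cmod_shift_ge v j Hv). assert (Hj := pos_INR j).
    assert (Hu0 : v + INR j <> 0) by (intro E; rewrite E, Cmod_0 in Hu; lra).
    assert (H1 := Cmod_Cpower_le (v + INR j) (- s) Hu0).
    assert (H2 := Rpower_anti (INR j + 2) (Cmod (v + INR j)) (Re s) ltac:(lra) ltac:(lra)).
    replace (Re (- s)) with (- Re s)%R in H1 by reflexivity.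
    replace (Im (- s)) with (- Im s)%R in H1 by reflexivity.
    rewrite Rabs_Ropp in H1. fold (Rpower (Cmod (v + INR j)) (- Re s)) in H1.
    assert (H3 := Cmod_pow_le_1 z j Hz).
    assert (He := exp_pos (PI * Rabs (Im s))).
    apply Rle_trans with (Cmod (Cpower (v + INR j) (- s)) * 1)%R.
    + apply Rmult_le_compat_l; [apply Cmod_ge_0|assumption].
    + rewrite Rmult_1_r. apply Rle_trans with (1 := H1). rewrite Rmult_comm.
      apply Rmult_le_compat_l; lra.
  - apply (ex_series_scal_l (K := R_AbsRing) (V := R_NormedModule)
             (exp (PI * Rabs (Im s))) (fun j => Rpower (INR j + 2) (- Re s))).
    now apply ex_series_Rpower.
Qed.

(** A power of [|v + j|] is at most a constant times [exp (e * |v + j|)] for any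
    positive [e], and [e] is chosen with [exp e * |z| < 1]. *)
Lemma ex_lerch_inside (z v s : C) :
  (Cmod z < 1)%R -> (2 <= Re v)%R -> exists w, is_lerch_series z s v w.
Proof.
  intros Hz Hv.
  set (rho := Rmax (Cmod z) (/ 2)).
  assert (Hrho : (0 < rho < 1)%R).
  { unfold rho. split; [apply Rlt_le_trans with (/ 2)%R; [lra|apply Rmax_r]|].
    apply Rmax_lub_lt; lra. }
  (* [exp e = rho^(-1/2)]; [rho] replaces [|z|] to allow [z = 0]. *)
  set (e := (- ln rho / 2)%R).
  assert (He : (0 < e)%R).
  { assert (H := ln_increasing rho 1 ltac:(lra) ltac:(lra)). rewrite ln_1 in H.
    unfold e. lra. }
  assert (Hq : (0 < exp e * rho < 1)%R).
  { split; [apply Rmult_lt_0_compat; [apply exp_pos|lra]|].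
    rewrite <- (exp_ln rho) at 1 by lra. rewrite <- exp_plus, <- exp_0.
    apply exp_increasing. unfold e in *. lra. }
  destruct (nat_above (Rabs (Re s))) as [P HP].
  set (A := (exp (PI * Rabs (Im s)) * (INR (fact P) * / e ^ P) * exp (e * Cmod v))%R).
  apply ex_Cseries_le with (fun j => (A * (exp e * rho) ^ j)%R).
  - intro j. unfold lerch_term. rewrite Cmod_mult, Cmod_pow.
    assert (Hu2 := Cmod_shift_ge_2 v j Hv).
    assert (Hu0 : v + INR j <> 0) by (intro E; rewrite E, Cmod_0 in Hu2; lra).
    set (x := Cmod (v + INR j)) in *.
    assert (H1 := Cmod_Cpower_le (v + INR j) (- s) Hu0). fold x in H1.
    replace (Re (- s)) with (- Re s)%R in H1 by reflexivity.
    replace (Im (- s)) with (- Im s)%R in H1 by reflexivity.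
    rewrite Rabs_Ropp in H1.
    assert (Hep : (0 < e ^ P)%R) by now apply pow_lt.
    assert (HF := INR_fact_pos P).
    assert (H2 : (exp (- Re s * ln x) <= x ^ P)%R).
    { rewrite <- Rpower_pow by lra. apply exp_monotone.
      apply Rmult_le_compat_r; [apply ln_nonneg; lra|].
      assert (H := Rle_abs (- Re s)). rewrite Rabs_Ropp in H. lra. }
    assert (H3 : (x ^ P <= INR (fact P) * / e ^ P * exp (e * x))%R).
    { assert (Hex : (0 <= e * x)%R) by (apply Rmult_le_pos; lra).
      assert (H := exp_partial_le (e * x) P Hex).
      assert (Hk : ((e * x) ^ P / INR (fact P) <= exp (e * x))%R).
      { apply Rle_trans with (2 := H).
        assert (Hpos : forall k, (0 <= (e * x) ^ k / INR (fact k))%R).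
        { intro k. apply Rmult_le_pos; [now apply pow_le|].
          left. apply Rinv_0_lt_compat, INR_fact_pos. }
        exact (term_le_sum_n _ P Hpos). }
      replace (x ^ P)%R with (INR (fact P) * / e ^ P * ((e * x) ^ P / INR (fact P)))%R
        by (rewrite Rpow_mult_distr; field; lra).
      apply Rmult_le_compat_l; [|assumption].
      apply Rmult_le_pos; [lra|]. left. now apply Rinv_0_lt_compat. }
    assert (H4 : (exp (e * x) <= exp (e * Cmod v) * exp e ^ j)%R).
    { assert (Hx : (x <= Cmod v + INR j)%R).
      { unfold x. apply Rle_trans with (1 := Cmod_triangle _ _). rewrite Cmod_INR. lra. }
      replace (exp e ^ j)%R with (exp (INR j * e)).
      - rewrite <- exp_plus. apply exp_monotone.
        apply (Rmult_le_compat_l e) in Hx; [lra|lra].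
      - clear. induction j as [|j IH]; [simpl; rewrite Rmult_0_l; apply exp_0|].
        rewrite S_INR, Rmult_plus_distr_r, exp_plus, IH, Rmult_1_l. simpl. ring. }
    rewrite Rpow_mult_distr.
    apply Rle_trans with (A * exp e ^ j * rho ^ j)%R; [|right; ring].
    apply Rmult_le_compat; [apply Cmod_ge_0|apply pow_le, Cmod_ge_0| |].
    + apply Rle_trans with (1 := H1). unfold A.
      set (B := exp (PI * Rabs (Im s))). assert (HB : (0 < B)%R) by apply exp_pos.
      rewrite (Rmult_comm _ B), !Rmult_assoc. apply Rmult_le_compat_l; [lra|].
      apply Rle_trans with (1 := H2). apply Rle_trans with (1 := H3).
      rewrite !Rmult_assoc. apply Rmult_le_compat_l; [lra|].
      apply Rmult_le_compat_l; [left; now apply Rinv_0_lt_compat|assumption].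
    + apply pow_incr. split; [apply Cmod_ge_0|apply Rmax_l].
  - apply (ex_series_scal_l (K := R_AbsRing) (V := R_NormedModule) A
             (fun j => ((exp e * rho) ^ j)%R)).
    exists (/ (1 - exp e * rho))%R. apply is_series_geom. rewrite Rabs_pos_eq; lra.
Qed.

(** * The functional equation and the continuation of the Lerch series *)

(** Binomial expansion of each difference; the double series converges
    absolutely since its [(j, l)] term is dominated by
    [(j + 2)^(Re w - 1) * rising x (l + 1) * 2^(-l)]. *)
Lemma lerch_difference_expansion (z v : C) (Phi : C -> C) (w : C) :
  (Cmod z <= 1)%R -> (2 <= Re v)%R -> (Re w < 0)%R ->
  (forall s, (1 < Re s)%R -> is_lerch_series z s v (Phi s)) ->
  exists T : C,
    is_Cseries (fun j => z ^ j * (Cpower (v + INR (S j)) w - Cpower (v + INR j) w)) T /\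
    is_Cseries (fun l => Cbinom w (S l) * Phi (INR (S l) - w)) T.
Proof.
  intros Hz Hv Hw HPhi.
  set (x := (Cmod w + 1)%R).
  assert (Hx : (0 < x)%R) by (unfold x; assert (H := Cmod_ge_0 w); lra).
  set (Sg := Series (fun l => rising x (S l) * (/ 2) ^ l)%R).
  assert (Hrpos : forall l, (0 <= rising x (S l) * (/ 2) ^ l)%R).
  { intro l. apply Rmult_le_pos; [left; now apply rising_pos|apply pow_le; lra]. }
  assert (HSg : ex_series (fun l => rising x (S l) * (/ 2) ^ l)%R).
  { assert (H := ex_series_rising x (/ 2) Hx ltac:(lra)).
    apply (ex_series_incr_1 (K := R_AbsRing) (V := R_NormedModule)) in H.
    apply (ex_series_scal_l (K := R_AbsRing) (V := R_NormedModule) 2%R) in H.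
    apply ex_series_ext with (2 := H). intro l.
    change (2 * (rising x (S l) * (/ 2 * (/ 2) ^ l)) = rising x (S l) * (/ 2) ^ l)%R.
    field. }
  apply (fubini (fun j l => z ^ j * (Cbinom w (S l) * Cpower (v + INR j) (w - INR (S l))))
    (fun j => (exp (PI * Rabs (Im w)) * Sg * Rpower (INR j + 2) (- (1 - Re w)))%R)).
  - apply (ex_series_scal_l (K := R_AbsRing) (V := R_NormedModule)
             (exp (PI * Rabs (Im w)) * Sg)%R
             (fun j => Rpower (INR j + 2) (- (1 - Re w)))).
    apply ex_series_Rpower. lra.
  - intros j n.
    assert (Hu := Cmod_shift_ge v j Hv). assert (Hu2 := Cmod_shift_ge_2 v j Hv).
    assert (Hj := pos_INR j).
    assert (Hu0 : v + INR j <> 0) by (intro E; rewrite E, Cmod_0 in Hu; lra).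
    set (E := exp (PI * Rabs (Im w))). assert (HE : (0 < E)%R) by apply exp_pos.
    set (Q := Rpower (INR j + 2) (- (1 - Re w))). assert (HQ : (0 < Q)%R) by apply exp_pos.
    apply Rle_trans with (sum_n (fun l => (E * Q * (rising x (S l) * (/ 2) ^ l))%R) n).
    + apply sum_n_le_R. intro l. rewrite !Cmod_mult.
      assert (H1 := Cmod_Cpower_le (v + INR j) (w - INR (S l)) Hu0).
      replace (Im (w - INR (S l))) with (Im w) in H1 by (unfold Im; simpl; ring).
      replace (Re (w - INR (S l))) with (- (1 - Re w + INR l))%R in H1
        by (rewrite S_INR; unfold Re; simpl; ring).
      fold E in H1. fold (Rpower (Cmod (v + INR j)) (- (1 - Re w + INR l))) in H1.
      assert (H2 := Rpower_shift_le (Cmod (v + INR j)) (1 - Re w) l Hu2).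
      assert (H3 := Rpower_anti (INR j + 2) (Cmod (v + INR j)) (1 - Re w) ltac:(lra) ltac:(lra)).
      fold Q in H3.
      assert (Hl : (0 < (/ 2) ^ l)%R) by (apply pow_lt; lra).
      assert (H4 := Cmod_Cbinom_le w x (S l) ltac:(unfold x; lra)).
      assert (H5 := Cmod_pow_le_1 z j Hz).
      assert (H6 : (Cmod (Cpower (v + INR j) (w - INR (S l))) <= (/ 2) ^ l * Q * E)%R).
      { apply Rle_trans with (1 := H1). apply Rmult_le_compat_r; [lra|].
        apply Rle_trans with (1 := H2). apply Rmult_le_compat_l; lra. }
      assert (H7 : (Cmod (Cbinom w (S l)) * Cmod (Cpower (v + INR j) (w - INR (S l)))
                    <= rising x (S l) * ((/ 2) ^ l * Q * E))%R).
      { apply Rmult_le_compat; auto using Cmod_ge_0. }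
      apply Rle_trans with (1 * (rising x (S l) * ((/ 2) ^ l * Q * E)))%R; [|right; ring].
      apply Rmult_le_compat; auto using Cmod_ge_0.
      apply Rmult_le_pos; apply Cmod_ge_0.
    + rewrite sum_n_scal_R. assert (H := sum_n_le_Series _ n Hrpos HSg). fold Sg in H.
      apply (Rmult_le_compat_l (E * Q)) in H; [|apply Rmult_le_pos; lra]. lra.
  - intro j. apply is_Cseries_scal.
    assert (Hre : (0 < Re (v + INR j))%R)
      by (rewrite Re_plus_R; assert (H := pos_INR j); lra).
    assert (H := Cbinom_series w (v + INR j) Hre (Cmod_shift_ge_2 v j Hv)).
    apply is_Cseries_cons in H.
    rewrite S_INR, RtoC_plus, Cplus_assoc.
    replace (Cpower (v + INR j) w) with (Cbinom w 0 * Cpower (v + INR j) (w - INR 0)).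
    + exact H.
    + simpl. replace (w - 0) with w by ring. ring.
  - intro l.
    assert (Hre : (1 < Re (INR (S l) - w))%R).
    { replace (Re (INR (S l) - w)) with (INR (S l) - Re w)%R
        by (unfold Re; simpl; ring).
      rewrite S_INR. assert (H := pos_INR l). lra. }
    apply is_Cseries_ext with (2 := is_Cseries_scal (Cbinom w (S l)) _ _ (HPhi _ Hre)).
    intro j. unfold lerch_term.
    replace (- (INR (S l) - w)) with (w - INR (S l)) by ring. ring.
Qed.

Lemma analytic_at_Cpower (u : C) s0 : u <> 0 -> analytic_at (fun s => Cpower u (- s)) s0.
Proof.
  intro Hu. exists 1%R. eexists. split; [lra|].
  apply wiener_ext with (2 := wiener_Cexp s0 1 (- Clog u) Rle_0_1).
  intros s _. rewrite Cpower_Cexp by assumption. f_equal. ring.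
Qed.

Lemma wiener_const_sub s0 r a :
  (0 <= r)%R -> wiener s0 r (Cmod a + (Cmod s0 + r))%R (fun s => a - s).
Proof.
  intro Hr.
  apply wiener_ext with (fun s => a + (- (1)) * s).
  - intros s _. ring.
  - apply wiener_plus; [assumption|apply wiener_const|].
    replace (Cmod s0 + r)%R with (Cmod (- (1)) * (Cmod s0 + r))%R
      by (rewrite Cmod_m1; ring).
    apply wiener_scal. now apply wiener_id.
Qed.

Lemma analytic_at_Cbinom a l s0 : analytic_at (fun s => Cbinom (a - s) l) s0.
Proof.
  exists 1%R. eexists. split; [lra|].
  apply wiener_Cbinom; [lra|]. apply wiener_const_sub. lra.
Qed.

Lemma wiener_lerch_tail (z v : C) (Phi : C -> C) s0 :
  (Cmod z <= 1)%R -> (2 <= Re v)%R ->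
  (forall s, (1 < Re s)%R -> is_lerch_series z s v (Phi s)) ->
  exists l0 K, forall l : nat, (l0 <= l)%nat ->
    wiener s0 1 (K * (/ 2) ^ l)%R (fun s => Phi (s + INR l)).
Proof.
  intros Hz Hv HPhi.
  destruct (nat_above (2 - Re s0)%R) as [l0 Hl0].
  set (A := (exp (PI * (Rabs (Im (s0 + INR l0)) + 1)) *
     Series (fun j => Rpower (INR j + 2) (- (Re (s0 + INR l0) - 1))))%R).
  exists l0, (2 ^ l0 * A)%R. intros l Hl.
  replace (2 ^ l0 * A * (/ 2) ^ l)%R with ((/ 2) ^ (l - l0) * A)%R.
  - apply wiener_ext with (fun s => Phi (s + INR l0 + INR (l - l0))).
    { intros s _. f_equal. rewrite minus_INR, RtoC_minus by assumption. ring. }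
    apply (wiener_translate s0 1 _ (fun s => Phi (s + INR (l - l0)))).
    apply (wiener_lerch z v); auto; [lra|]. rewrite Re_plus_R. lra.
  - assert (E : ((/ 2) ^ l = / 2 ^ l0 * (/ 2) ^ (l - l0))%R).
    { rewrite <- pow_inv, <- pow_add. f_equal. lia. }
    rewrite E. field. apply pow_nonzero. lra.
Qed.

Lemma analytic_at_lerch (z v : C) (Phi : C -> C) s0 :
  (Cmod z <= 1)%R -> (2 <= Re v)%R ->
  (forall s, (1 < Re s)%R -> is_lerch_series z s v (Phi s)) ->
  (1 < Re s0)%R -> analytic_at Phi s0.
Proof.
  intros Hz Hv HPhi Hs0.
  exists ((Re s0 - 1) / 2)%R. eexists. split; [lra|].
  apply wiener_ext with (2 := wiener_lerch z v Phi s0 ((Re s0 - 1) / 2) Hz Hv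
     ltac:(lra) ltac:(lra) HPhi 0).
  intros s _. f_equal. simpl. ring.
Qed.

Lemma ex_series_rising_tail x K :
  (0 < x)%R -> ex_series (fun l => (rising x l * (K * (/ 2) ^ l))%R).
Proof.
  intro Hx.
  assert (H := ex_series_rising x (/ 2) Hx ltac:(lra)).
  apply (ex_series_scal_l (K := R_AbsRing) (V := R_NormedModule) K) in H.
  apply ex_series_ext with (2 := H). intro l.
  change (K * (rising x l * (/ 2) ^ l) = rising x l * (K * (/ 2) ^ l))%R. ring.
Qed.

Lemma ex_right_sum (z v : C) :
  (Cmod z <= 1)%R -> (2 <= Re v)%R ->
  exists Phi : C -> C, forall s, (1 < Re s)%R -> is_lerch_series z s v (Phi s).
Proof.
  intros Hz Hv.
  apply (functional_choice (fun s w => (1 < Re s)%R -> is_lerch_series z s v w)).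
  intro s. destruct (Rlt_dec 1 (Re s)) as [Hs|Hs].
  - destruct (ex_lerch_right z v s Hz Hv Hs) as [w Hw]. now exists w.
  - exists 0. intro H. contradiction.
Qed.

Lemma Cminus_neq_0 (x y : C) : x <> y -> x - y <> 0.
Proof.
  intros H E. apply H. replace x with (x - y + y) by ring. rewrite E. ring.
Qed.

(** With [T] the sum of [lerch_difference_expansion] at [w = - s], shifting the
    index gives [z T = Phi s - v^(-s) - z Phi s], to be solved for [Phi s]. *)
Lemma lerch_continuation_generic (z v : C) (Phi : C -> C) :
  (Cmod z <= 1)%R -> z <> 1 -> (2 <= Re v)%R ->
  (forall s, (1 < Re s)%R -> is_lerch_series z s v (Phi s)) ->
  exists F : C -> C, (forall s0, analytic_at F s0) /\
    (forall s, (1 < Re s)%R -> F s = Phi s).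
Proof.
  intros Hz Hz1 Hv HPhi.
  assert (Hv0 : v <> 0) by (intros ->; simpl in Hv; lra).
  assert (H1z : 1 - z <> 0) by (apply Cminus_neq_0; auto).
  apply (entire_continuation (fun l s => z / (1 - z) * Cbinom (0 - s) (S l))
           (fun s => / (1 - z) * Cpower v (- s))).
  - intros l s0. apply analytic_at_mult; [apply analytic_at_const|apply analytic_at_Cbinom].
  - intro s0. apply analytic_at_mult; [apply analytic_at_const|now apply analytic_at_Cpower].
  - intros s0. now apply (analytic_at_lerch z v).
  - intro s0. destruct (wiener_lerch_tail z v Phi s0 Hz Hv HPhi) as [l0 [K HK]].
    set (x := (Cmod 0 + (Cmod s0 + 1))%R).
    assert (Hx : (0 < x)%R).
    { unfold x. rewrite Cmod_0. assert (H := Cmod_ge_0 s0). lra. }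
    exists 1%R, l0,
      (fun l => (Cmod (z / (1 - z)) * (rising x (S l) * (K * (/ 2) ^ (S l))))%R).
    split; [lra|]. split.
    + apply (ex_series_scal_l (K := R_AbsRing) (V := R_NormedModule)
               (Cmod (z / (1 - z))) (fun l => rising x (S l) * (K * (/ 2) ^ S l))%R).
      apply (ex_series_incr_1 (K := R_AbsRing) (V := R_NormedModule)
               (fun l => (rising x l * (K * (/ 2) ^ l))%R)).
      now apply ex_series_rising_tail.
    + intros l Hl.
      apply wiener_ext with
        (fun s => z / (1 - z) * (Cbinom (0 - s) (S l) * Phi (s + INR (S l)))).
      { intros s _. ring. }
      apply wiener_scal. apply wiener_mult; [lra| |apply HK; lia].
      apply wiener_Cbinom; [lra|]. apply wiener_const_sub. lra.
  - intros s Hs.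
    assert (Hw : (Re (0 - s) < 0)%R) by (unfold Re in *; simpl; lra).
    destruct (lerch_difference_expansion z v Phi (0 - s) Hz Hv Hw HPhi) as [T [HT1 HT2]].
    assert (HP := HPhi s Hs). unfold is_lerch_series in HP.
    assert (HP' := proj1 (is_Cseries_cons _ _) HP).
    assert (E : z * T = Phi s - lerch_term z s v 0 - z * Phi s).
    { apply (is_Cseries_unique _ _ _ (is_Cseries_scal z _ _ HT1)).
      apply is_Cseries_ext with
        (2 := is_Cseries_minus _ _ _ _ HP' (is_Cseries_scal z _ _ HP)).
      intro j. unfold lerch_term. replace (0 - s) with (- s) by ring.
      cbn [Cpow]. ring. }
    unfold lerch_term in E. simpl in E. rewrite Cplus_0_r in E.
    replace (Phi s - / (1 - z) * Cpower v (- s)) with (z / (1 - z) * T).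
    + apply is_Cseries_ext with (2 := is_Cseries_scal (z / (1 - z)) _ _ HT2).
      intro l. replace (INR (S l) - (0 - s)) with (s + INR (S l)) by ring. ring.
    + transitivity (z * T / (1 - z)); [field; assumption|].
      rewrite E. field. assumption.
Qed.

Lemma Cpower_shift_tends_0 (v w : C) :
  (2 <= Re v)%R -> (Re w < 0)%R -> Ctends (fun n => Cpower (v + INR n) w) 0.
Proof.
  intros Hv Hw eps He.
  set (E := exp (PI * Rabs (Im w))). assert (HE : (0 < E)%R) by apply exp_pos.
  assert (HeE : (0 < eps / E)%R) by now apply Rdiv_lt_0_compat.
  destruct (nat_above (exp (ln (eps / E) / Re w))%R) as [N HN].
  exists N. intros n Hn. apply le_INR in Hn.
  replace (Cpower (v + INR n) w - 0) with (Cpower (v + INR n) w) by ring.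
  assert (Hu := Cmod_shift_ge v n Hv). assert (Hn0 := pos_INR n).
  assert (Hu0 : v + INR n <> 0) by (intro E0; rewrite E0, Cmod_0 in Hu; lra).
  apply Rle_lt_trans with (1 := Cmod_Cpower_le _ w Hu0). fold E.
  apply Rlt_le_trans with (eps / E * E)%R; [|right; field; lra].
  apply Rmult_lt_compat_r; [assumption|].
  rewrite <- (exp_ln (eps / E)) by assumption. apply exp_increasing.
  assert (Hln : (ln (eps / E) / Re w < ln (Cmod (v + INR n)))%R).
  { rewrite <- (ln_exp (ln (eps / E) / Re w)). apply ln_increasing; [apply exp_pos|lra]. }
  replace (ln (eps / E)) with (Re w * (ln (eps / E) / Re w))%R by (field; lra).
  apply (Rmult_lt_compat_l (- Re w)) in Hln; [|lra]. lra.
Qed.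

(** At [z = 1] the differences telescope to [- v^(1-s)] when [w = 1 - s].  The
    relation is between the [Phi (s + l)], which has a pole at [s = 1 - l]; for
    [G s = (s - 1) Phi s] the coefficients stay entire because the binomial
    coefficient [C(1-s, l+1)] contains the factor [1 - s - l]. *)
Lemma hurwitz_continuation (v : C) (Phi : C -> C) :
  (2 <= Re v)%R ->
  (forall s, (1 < Re s)%R -> is_lerch_series 1 s v (Phi s)) ->
  exists F : C -> C, (forall s0, analytic_at F s0) /\
    (forall s, (1 < Re s)%R -> F s = (s - 1) * Phi s).
Proof.
  intros Hv HPhi.
  assert (Hz : (Cmod 1 <= 1)%R) by (rewrite Cmod_1; lra).
  assert (Hv0 : v <> 0) by (intros ->; simpl in Hv; lra).
  assert (Hterm : forall l s, (- / INR (S (S l)) * Cbinom (1 - s) (S l)) *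
      ((s + INR (S l) - 1) * Phi (s + INR (S l)))
      = Cbinom (1 - s) (S (S l)) * Phi (s + INR (S l))).
  { intros l s.
    change (Cbinom (1 - s) (S (S l)))
      with (Cbinom (1 - s) (S l) * (1 - s - INR (S l)) / INR (S (S l))).
    field. apply RtoC_neq_0, lt_0_INR. lia. }
  apply (entire_continuation (fun l s => - / INR (S (S l)) * Cbinom (1 - s) (S l))
           (fun s => v * Cpower v (- s)) (fun s => (s - 1) * Phi s)).
  - intros l s0. apply analytic_at_mult; [apply analytic_at_const|apply analytic_at_Cbinom].
  - intro s0. apply analytic_at_mult; [apply analytic_at_const|now apply analytic_at_Cpower].
  - intros s0 Hs0. apply analytic_at_mult.
    + apply analytic_at_minus; [apply analytic_at_id|apply analytic_at_const].
    + now apply (analytic_at_lerch 1 v).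
  - intro s0. destruct (wiener_lerch_tail 1 v Phi s0 Hz Hv HPhi) as [l0 [K HK]].
    set (x := (Cmod 1 + (Cmod s0 + 1))%R).
    assert (Hx : (0 < x)%R).
    { unfold x. rewrite Cmod_1. assert (H := Cmod_ge_0 s0). lra. }
    exists 1%R, l0, (fun l => (rising x (S (S l)) * ((2 * K) * (/ 2) ^ (S (S l))))%R).
    split; [lra|]. split.
    + apply (ex_series_incr_n (K := R_AbsRing) (V := R_NormedModule)
               (fun l => (rising x l * ((2 * K) * (/ 2) ^ l))%R) 2).
      now apply ex_series_rising_tail.
    + intros l Hl.
      apply wiener_ext with (fun s => Cbinom (1 - s) (S (S l)) * Phi (s + INR (S l))).
      { intros s _. symmetry. apply Hterm. }
      replace (2 * K * (/ 2) ^ S (S l))%R with (K * (/ 2) ^ S l)%R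
        by (simpl; field).
      apply wiener_mult; [lra| |apply HK; lia].
      apply wiener_Cbinom; [lra|]. apply wiener_const_sub. lra.
  - intros s Hs.
    assert (Hw : (Re (1 - s) < 0)%R) by (unfold Re in *; simpl; lra).
    destruct (lerch_difference_expansion 1 v Phi (1 - s) Hz Hv Hw HPhi) as [T [HT1 HT2]].
    assert (ET : T = 0 + - Cpower v (1 - s)).
    { apply is_Cseries_tends in HT1. apply (Ctends_unique _ _ _ HT1).
      apply Ctends_ext with (fun n => Cpower (v + INR (S n)) (1 - s) + - Cpower v (1 - s)).
      - intro n. induction n as [|n IH].
        + rewrite sum_O. rewrite Cpow_1_l. simpl INR. rewrite Cplus_0_r. ring.
        + rewrite sum_n_S_C, <- IH, Cpow_1_l. ring.
      - apply Ctends_plus.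
        + intros eps He. destruct (Cpower_shift_tends_0 v (1 - s) Hv Hw eps He) as [N HN].
          exists N. intros n Hn. apply HN. lia.
        + intros eps He. exists 0%nat. intros n _.
          replace (- Cpower v (1 - s) - - Cpower v (1 - s)) with (RtoC 0) by ring.
          now rewrite Cmod_0. }
    apply is_Cseries_cons in HT2.
    apply is_Cseries_ext with (fun l => Cbinom (1 - s) (S (S l)) * Phi (INR (S (S l)) - (1 - s))).
    + intro l. rewrite Hterm. do 2 f_equal. rewrite (S_INR (S l)), RtoC_plus. ring.
    + replace ((s - 1) * Phi s - v * Cpower v (- s))
        with (T - Cbinom (1 - s) 1 * Phi (INR 1 - (1 - s))); [exact HT2|].
      assert (Ev : Cpower v (1 - s) = v * Cpower v (- s)).
      { unfold Cminus. now rewrite Cpower_plus, Cpower_1. }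
      rewrite ET, Ev.
      replace (INR 1 - (1 - s)) with s by (simpl; ring). simpl. field.
Qed.

Lemma ex_lerch_continuation_right (z v : C) :
  (Cmod z <= 1)%R -> (2 <= Re v)%R -> exists F, is_lerch_continuation z v F.
Proof.
  intros Hz Hv. destruct (ex_right_sum z v Hz Hv) as [Phi HPhi].
  destruct (Ceq_dec z 1) as [->|Hz1].
  - destruct (hurwitz_continuation v Phi Hv HPhi) as [F [HF1 HF2]].
    exists (fun s => F s * / (s - 1)). split.
    + apply analytic_on_iff. intros s0 Hs0. apply analytic_at_mult; [apply HF1|].
      apply analytic_at_inv_sub. intros ->. now apply Hs0.
    + intros s Hs. rewrite HF2 by assumption.
      replace ((s - 1) * Phi s * / (s - 1)) with (Phi s); [now apply HPhi|].
      field. apply Cminus_neq_0. intros ->. simpl in Hs. lra.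
  - destruct (lerch_continuation_generic z v Phi Hz Hz1 Hv HPhi) as [F [HF1 HF2]].
    exists F. split.
    + apply analytic_on_iff. intros s0 _. apply HF1.
    + intros s Hs. rewrite HF2 by assumption. now apply HPhi.
Qed.

Lemma is_lerch_series_shift (z s v w : C) :
  is_lerch_series z s (v + 1) w -> is_lerch_series z s v (Cpower v (- s) + z * w).
Proof.
  intro H. apply is_Cseries_cons.
  replace (Cpower v (- s) + z * w - lerch_term z s v 0) with (z * w).
  - apply is_Cseries_ext with (2 := is_Cseries_scal z _ _ H).
    intro j. unfold lerch_term. rewrite S_INR, RtoC_plus. cbn [Cpow].
    replace (v + 1 + INR j) with (v + (INR j + 1)) by ring. ring.
  - unfold lerch_term. simpl. rewrite Cplus_0_r. ring.
Qed.

(** * Existence and uniqueness for all third arguments *)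

Lemma lerch_shift_induction (P : C -> Prop) :
  (forall v, (2 <= Re v)%R -> P v) ->
  (forall v : C, v <> 0 -> P (v + 1) -> P v) ->
  forall v : C, (forall j : nat, v <> - INR j) -> P v.
Proof.
  intros Hright Hstep v Hv. destruct (nat_above (2 - Re v)%R) as [J HJ].
  revert v Hv HJ. induction J as [|J IH]; intros v Hv HJ.
  - apply Hright. simpl in HJ. lra.
  - apply Hstep.
    + intro E. apply (Hv 0%nat). rewrite E. simpl. ring.
    + apply IH.
      * intros j E. apply (Hv (S j)). rewrite S_INR, RtoC_plus.
        replace v with (v + 1 - 1) by ring. rewrite E. ring.
      * rewrite Re_plus_R. rewrite S_INR in HJ. lra.
Qed.

Lemma ex_lerch_series (z s v : C) :
  (Cmod z < 1)%R -> (forall j : nat, v <> - INR j) -> exists w, is_lerch_series z s v w.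
Proof.
  intro Hz. revert v. apply lerch_shift_induction.
  - intros v Hv. now apply ex_lerch_inside.
  - intros v _ [w Hw]. eexists. apply is_lerch_series_shift, Hw.
Qed.

Lemma ex_lerch_continuation (z v : C) :
  (Cmod z <= 1)%R -> (forall j : nat, v <> - INR j) ->
  exists F, is_lerch_continuation z v F.
Proof.
  intro Hz. revert v. apply lerch_shift_induction.
  - intros v Hv. now apply ex_lerch_continuation_right.
  - intros v Hv [F [HF1 HF2]]. exists (fun s => Cpower v (- s) + z * F s). split.
    + rewrite analytic_on_iff in HF1. apply analytic_on_iff. intros s0 Hs0.
      apply analytic_at_plus; [now apply analytic_at_Cpower|].
      apply analytic_at_mult; [apply analytic_at_const|auto].
    + intros s Hs. apply is_lerch_series_shift. auto.
Qed.

(** A ray from [s] must avoid [1]: a horizontal one does if [s] is not real, and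
    if [s] is real a slanted one leaves the real axis at once. *)
Lemma zero_on_lerch_domain (z : C) (f : C -> C) (s : C) :
  analytic_on (lerch_domain z) f -> (forall s, (1 < Re s)%R -> f s = 0) ->
  lerch_domain z s -> f s = 0.
Proof.
  intros Hf H0 Hs. rewrite analytic_on_iff in Hf.
  destruct (Req_dec (Im s) 0) as [Him|Him].
  - apply (zero_of_zero_far_right f s (1 + Ci)); [simpl; lra| |assumption].
    intros x Hx. apply Hf. intros [Hz E]. apply Hs. split; [assumption|].
    assert (E2 := f_equal Im E). unfold Im in *. simpl in E2.
    assert (x = 0)%R by lra. subst x. rewrite <- E. ring.
  - apply (zero_of_zero_far_right f s 1); [simpl; lra| |assumption].
    intros x Hx. apply Hf. intros [_ E]. apply Him.
    apply (f_equal Im) in E. unfold Im in *. simpl in E. lra.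
Qed.

Lemma analytic_on_minus D f g :
  analytic_on D f -> analytic_on D g -> analytic_on D (fun s => f s - g s).
Proof.
  rewrite !analytic_on_iff. intros Hf Hg s Hs. apply analytic_at_minus; auto.
Qed.

Lemma lerch_continuation_unique (z v s : C) (F F' : C -> C) :
  is_lerch_continuation z v F -> is_lerch_continuation z v F' ->
  lerch_domain z s -> F s = F' s.
Proof.
  intros [HF1 HF2] [HF1' HF2'] Hs.
  assert (E : F s - F' s = 0).
  { apply (zero_on_lerch_domain z (fun s => F s - F' s) s); [|clear s Hs; intros s Hs|assumption].
    - now apply analytic_on_minus.
    - rewrite (is_Cseries_unique _ _ _ (HF2 s Hs) (HF2' s Hs)). ring. }
  replace (F s) with (F s - F' s + F' s) by ring. rewrite E. ring.
Qed.

Lemma is_hurwitz_lerch_unique (z s v w w' : C) :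
  is_hurwitz_lerch z s v w -> is_hurwitz_lerch z s v w' -> w = w'.
Proof.
  intros [[Hz H]|[Hz [Hs [F [HF HFw]]]]] [[Hz' H']|[Hz' [Hs' [F' [HF' HFw']]]]]; try lra.
  - exact (is_Cseries_unique _ _ _ H H').
  - rewrite <- HFw, <- HFw'. now apply (lerch_continuation_unique z v).
Qed.

Lemma hurwitz_lerch_correct (z s v : C) :
  (Cmod z <= 1)%R -> hurwitz_lerch_defined z s v ->
  is_hurwitz_lerch z s v (hurwitz_lerch z s v).
Proof.
  intros Hz [Hv Hs]. apply (iota_correct (K := C_AbsRing) (V := C_CompleteNormedModule) (is_hurwitz_lerch z s v)).
  assert (Hex : exists w, is_hurwitz_lerch z s v w).
  { destruct (Rle_lt_or_eq_dec _ _ Hz) as [Hlt|Heq].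
    - destruct (ex_lerch_series z s v Hlt Hv) as [w Hw]. exists w. now left.
    - destruct (ex_lerch_continuation z v Hz Hv) as [F HF].
      exists (F s). right. split; [assumption|]. split; [assumption|]. now exists F. }
  destruct Hex as [w Hw]. exists w. split; [assumption|].
  intros w' Hw'. exact (is_hurwitz_lerch_unique z s v w w' Hw Hw').
Qed.

(** * The triplication formula *)

Lemma is_Cseries_group3 (a : nat -> C) (l : C) :
  is_Cseries a l ->
  is_Cseries (fun k => a (3 * k)%nat + a (3 * k + 1)%nat + a (3 * k + 2)%nat) l.
Proof.
  rewrite !is_Cseries_tends. intros H eps He. destruct (H eps He) as [N HN].
  exists N. intros n Hn.
  assert (E : Csum_n (fun k => a (3 * k)%nat + a (3 * k + 1)%nat + a (3 * k + 2)%nat) n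
              = Csum_n a (3 * n + 2) :> C).
  { clear. induction n as [|n IH].
    - rewrite sum_O. simpl. rewrite !sum_n_S_C, sum_O. reflexivity.
    - replace (3 * S n + 2)%nat with (S (S (S (3 * n + 2)))) by lia.
      rewrite sum_n_S_C, IH, !sum_n_S_C.
      replace (S (3 * n + 2)) with (3 * S n)%nat by lia.
      replace (S (3 * S n)) with (3 * S n + 1)%nat by lia.
      replace (S (3 * S n + 1)) with (3 * S n + 2)%nat by lia. ring. }
  rewrite E. apply HN. lia.
Qed.

Lemma lerch_series_triplication (z s v w w0 w1 w2 : C) :
  is_lerch_series z s v w ->
  is_lerch_series (z ^ 3) s (v / 3) w0 ->
  is_lerch_series (z ^ 3) s ((v + 1) / 3) w1 ->
  is_lerch_series (z ^ 3) s ((v + 2) / 3) w2 ->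
  w = Cpower 3 (- s) * (w0 + z * w1 + z ^ 2 * w2).
Proof.
  intros H H0 H1 H2.
  apply (is_Cseries_unique _ _ _ (is_Cseries_group3 _ _ H)).
  assert (Hr : forall (r k : nat), lerch_term z s v (3 * k + r)
    = Cpower 3 (- s) * (z ^ r * lerch_term (z ^ 3) s ((v + INR r) / 3) k)).
  { intros r k. unfold lerch_term.
    replace (v + INR (3 * k + r)) with (3 * ((v + INR r) / 3 + INR k)).
    - rewrite Cpower_scale by lra. rewrite Cpow_add_r, <- Cpow_mult_r. ring.
    - rewrite plus_INR, mult_INR, RtoC_plus, RtoC_mult.
      replace (INR 3) with 3%R by (simpl; ring). field. }
  apply is_Cseries_ext with
    (fun k => Cpower 3 (- s) * (lerch_term (z ^ 3) s (v / 3) k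
       + z * lerch_term (z ^ 3) s ((v + 1) / 3) k
       + z ^ 2 * lerch_term (z ^ 3) s ((v + 2) / 3) k)).
  - intro k. assert (E0 := Hr 0%nat k). rewrite Nat.add_0_r in E0.
    rewrite E0, !Hr. simpl INR. rewrite Cplus_0_r.
    replace (1 + 1)%R with 2%R by ring. simpl Cpow. ring.
  - apply is_Cseries_scal. apply is_Cseries_plus; [apply is_Cseries_plus|];
      [exact H0|apply is_Cseries_scal; exact H1|apply is_Cseries_scal; exact H2].
Qed.

(** On the unit circle [z ^ 3 = 1] is possible with [z <> 1].  The terms on the right are
    then singular at [s = 1], so both sides are compared on the domain of
    [z ^ 3], which is contained in that of [z]. *)
Lemma hurwitz_lerch_triplication (z s v : C) :
  (Cmod z <= 1)%R ->
  hurwitz_lerch_defined z s v ->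
  hurwitz_lerch_defined (z ^ 3) s (v / 3) ->
  hurwitz_lerch_defined (z ^ 3) s ((v + 1) / 3) ->
  hurwitz_lerch_defined (z ^ 3) s ((v + 2) / 3) ->
  hurwitz_lerch z s v =
  Cpower 3 (- s) * (hurwitz_lerch (z ^ 3) s (v / 3)
    + z * hurwitz_lerch (z ^ 3) s ((v + 1) / 3)
    + z ^ 2 * hurwitz_lerch (z ^ 3) s ((v + 2) / 3)).
Proof.
  intros Hz Hd Hd0 Hd1 Hd2.
  assert (Hz3 := Cmod_pow_le_1 z 3 Hz).
  assert (Hm : (Cmod z < 1 -> Cmod (z ^ 3) < 1)%R).
  { intro Hlt. rewrite Cmod_pow. simpl. assert (H := Cmod_ge_0 z).
    assert (H1 : (Cmod z * Cmod z <= 1)%R).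
    { rewrite <- (Rmult_1_l 1). apply Rmult_le_compat; lra. }
    apply Rle_lt_trans with (Cmod z * 1)%R; [|lra].
    apply Rmult_le_compat_l; lra. }
  assert (Hm1 : Cmod z = 1%R -> Cmod (z ^ 3) = 1%R).
  { intro E. rewrite Cmod_pow, E. ring. }
  assert (Hs3 := proj2 Hd0).
  destruct (hurwitz_lerch_correct _ _ _ Hz Hd) as [[Hlt H]|[Heq [Hs [F [[HFa HFs] <-]]]]].
  - specialize (Hm Hlt).
    destruct (hurwitz_lerch_correct _ _ _ Hz3 Hd0) as [[_ H0]|[E _]]; [|lra].
    destruct (hurwitz_lerch_correct _ _ _ Hz3 Hd1) as [[_ H1]|[E _]]; [|lra].
    destruct (hurwitz_lerch_correct _ _ _ Hz3 Hd2) as [[_ H2]|[E _]]; [|lra].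
    now apply (lerch_series_triplication z s v).
  - specialize (Hm1 Heq).
    destruct (hurwitz_lerch_correct _ _ _ Hz3 Hd0) as [[E _]|[_ [_ [F0 [[Ha0 Hs0] <-]]]]]; [lra|].
    destruct (hurwitz_lerch_correct _ _ _ Hz3 Hd1) as [[E _]|[_ [_ [F1 [[Ha1 Hs1] <-]]]]]; [lra|].
    destruct (hurwitz_lerch_correct _ _ _ Hz3 Hd2) as [[E _]|[_ [_ [F2 [[Ha2 Hs2] <-]]]]]; [lra|].
    set (g := fun s => Cpower 3 (- s) * (F0 s + z * F1 s + z ^ 2 * F2 s)).
    change (F s = g s).
    assert (E : F s - g s = 0).
    { apply (zero_on_lerch_domain (z ^ 3) (fun s => F s - g s)); [| |assumption].
      - apply analytic_on_minus.
        + rewrite analytic_on_iff in *. intros s1 Hs1'. apply HFa.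
          intros [Ez E1]. apply Hs1'. split; [|assumption]. rewrite Ez. ring.
        + rewrite analytic_on_iff in *. intros s1 Hs1'. unfold g.
          apply analytic_at_mult; [apply analytic_at_Cpower, RtoC_neq_0; lra|].
          apply analytic_at_plus; [apply analytic_at_plus|];
            [auto|apply analytic_at_mult|apply analytic_at_mult];
            auto using analytic_at_const.
      - intros s1 Hs1'. unfold g.
        rewrite (lerch_series_triplication z s1 v (F s1) (F0 s1) (F1 s1) (F2 s1)); auto.
        ring. }
    replace (F s) with (F s - g s + g s) by ring. rewrite E. ring.
Qed.

(** * The telescoping sum *)

Lemma Cpow3_neq_0 p : (3 : C) ^ p <> 0.
Proof. apply Cpow_nz, RtoC_neq_0. lra. Qed.

(** The weights match: [3 * 3^(-p-1) = 3^(-p)], so only [h 0] and [h (n+1)]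
    survive; the terms in [A] form a geometric sum. *)
Lemma telescoping_sum (A B : C) (h : nat -> C) (n : nat) :
  Csum_n (fun p => / 3 ^ p * A - 3 * / 3 ^ p * B * h p + / 3 ^ p * B * h (S p)) n
  = 1 / 2 * / 3 ^ n * ((3 ^ S n - 1) * A + 2 * B * (h (S n) - 3 ^ S n * h 0%nat)) :> C.
Proof.
  assert (H2 : RtoC 2 <> 0) by (apply RtoC_neq_0; lra).
  assert (H3 : RtoC 3 <> 0) by (apply RtoC_neq_0; lra).
  induction n as [|n IH].
  - rewrite sum_O. cbn [Cpow]. field.
  - rewrite sum_n_S_C, IH. assert (H := Cpow3_neq_0 n).
    cbn [Cpow]. field. repeat split; assumption.
Qed.

Theorem theorem6p1 (n : nat) (k a m : C)
  (hn : (1 <= n)%nat) (ha : a <> 0) (hm : (0 <= Im m)%R)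
  (hlog : Cpower_defined (Clog a) k)
  (hsum : forall p : nat, (p < n)%nat ->
     hurwitz_lerch_defined (- Cexp (2 * Ci * 3 ^ (p + 1) * m)) (- k)
       (1 / 6 * (2 - Ci * / 3 ^ p * Clog a)) /\
     hurwitz_lerch_defined (- Cexp (2 * Ci * 3 ^ (p + 1) * m)) (- k)
       (1 / 6 * (4 - Ci * / 3 ^ p * Clog a)) /\
     hurwitz_lerch_defined (- Cexp (2 * Ci * 3 ^ (p + 1) * m)) (- k)
       (1 / 6 * (6 - Ci * / 3 ^ p * Clog a)))
  (hrhs_n : hurwitz_lerch_defined (- Cexp (2 * Ci * 3 ^ n * m)) (- k)
     (1 - 1 / 2 * Ci * / 3 ^ n * Clog a))
  (hrhs_0 : hurwitz_lerch_defined (- Cexp (2 * Ci * m)) (- k)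
     (1 - 1 / 2 * Ci * Clog a)) :
  sum_n (G := C_AbelianMonoid) (fun p : nat =>
    / 3 ^ p *
    (Cpower (Clog a) k +
     Cpower 2 k * Cpower (Ci * 3 ^ (p + 1)) k * Cexp (2 * Ci * m * 3 ^ p) *
     (- 3 * hurwitz_lerch (- Cexp (2 * Ci * 3 ^ (p + 1) * m)) (- k)
              (1 / 6 * (2 - Ci * / 3 ^ p * Clog a))
      + 3 * Cexp (2 * Ci * m * 3 ^ p) *
          hurwitz_lerch (- Cexp (2 * Ci * 3 ^ (p + 1) * m)) (- k)
              (1 / 6 * (4 - Ci * / 3 ^ p * Clog a))
      - 2 * Cexp (4 * Ci * m * 3 ^ p) *
          hurwitz_lerch (- Cexp (2 * Ci * 3 ^ (p + 1) * m)) (- k)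
              (1 / 6 * (6 - Ci * / 3 ^ p * Clog a))))) (n - 1)
  =
  1 / 2 * / 3 ^ (n - 1) *
  ((3 ^ n - 1) * Cpower (Clog a) k +
   Cpower 2 (k + 1) *
   (Cpower (Ci * 3 ^ n) k * Cexp (2 * Ci * m * 3 ^ n) *
      hurwitz_lerch (- Cexp (2 * Ci * 3 ^ n * m)) (- k)
        (1 - 1 / 2 * Ci * / 3 ^ n * Clog a)
    - Cpower Ci k * Cexp (2 * Ci * m) * 3 ^ n *
      hurwitz_lerch (- Cexp (2 * Ci * m)) (- k)
        (1 - 1 / 2 * Ci * Clog a))).
Proof.
  assert (H2 : RtoC 2 <> 0) by (apply RtoC_neq_0; lra).
  assert (H3 : RtoC 3 <> 0) by (apply RtoC_neq_0; lra).
  assert (H6 : RtoC 6 <> 0) by (apply RtoC_neq_0; lra).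
  set (L := Clog a) in *.
  set (z := fun p : nat => - Cexp (2 * Ci * 3 ^ p * m)).
  set (v := fun p : nat => 1 - 1 / 2 * Ci * / 3 ^ p * L).
  set (h := fun p : nat => Cpower (Ci * 3 ^ p) k * Cexp (2 * Ci * m * 3 ^ p)
                           * hurwitz_lerch (z p) (- k) (v p)).
  assert (Hexp : forall p, Cexp (2 * Ci * m * 3 ^ p) = - z p).
  { intro p. unfold z. transitivity (Cexp (2 * Ci * 3 ^ p * m)); [f_equal|]; ring. }
  assert (Hz3 : forall p, z (S p) = z p ^ 3).
  { intro p. unfold z.
    replace (2 * Ci * 3 ^ S p * m) with (INR 3 * (2 * Ci * 3 ^ p * m)).
    - rewrite Cexp_mul_nat. ring.
    - replace (INR 3) with 3%R by (simpl; ring). cbn [Cpow]. ring. }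
  assert (Hzle : forall p, (Cmod (z p) <= 1)%R).
  { intro p. unfold z. rewrite Cmod_opp, Cmod_Cexp, <- exp_0. apply exp_monotone.
    rewrite <- RtoC_pow.
    replace (Re (2 * Ci * RtoC (3 ^ p) * m)) with (- (2 * 3 ^ p * Im m))%R
      by (unfold Re, Im; simpl; ring).
    assert (H : (0 <= 2 * 3 ^ p * Im m)%R).
    { apply Rmult_le_pos; [|assumption]. apply Rmult_le_pos; [lra|apply pow_le; lra]. }
    lra. }
  assert (Hv0 : forall p, 1 / 6 * (2 - Ci * / 3 ^ p * L) = v p / 3).
  { intro p. unfold v. assert (H := Cpow3_neq_0 p).
    field. auto. }
  assert (Hv1 : forall p, 1 / 6 * (4 - Ci * / 3 ^ p * L) = (v p + 1) / 3).
  { intro p. unfold v. assert (H := Cpow3_neq_0 p).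
    field. auto. }
  assert (Hv2 : forall p, 1 / 6 * (6 - Ci * / 3 ^ p * L) = (v p + 2) / 3).
  { intro p. unfold v. assert (H := Cpow3_neq_0 p).
    field. auto. }
  assert (Hv3 : forall p, (v p + 2) / 3 = v (S p)).
  { intro p. unfold v. assert (H := Cpow3_neq_0 p).
    cbn [Cpow]. field. auto. }
  assert (Hdef : forall p, (p <= n)%nat -> hurwitz_lerch_defined (z p) (- k) (v p)).
  { intros [|p] Hp.
    - unfold z, v. simpl Cpow. rewrite Cmult_1_r.
      replace (1 - 1 / 2 * Ci * / 1 * L) with (1 - 1 / 2 * Ci * L) by (field; auto).
      assumption.
    - rewrite <- Hv3, <- Hv2. unfold z. rewrite <- Nat.add_1_r. apply (hsum p Hp). }
  destruct n as [|n]; [lia|]. replace (S n - 1)%nat with n by lia.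
  rewrite Cpower_plus, Cpower_1 by assumption.
  transitivity (Csum_n (fun p => / 3 ^ p * Cpower L k
      - 3 * / 3 ^ p * Cpower 2 k * h p + / 3 ^ p * Cpower 2 k * h (S p)) n).
  - apply (sum_n_ext_loc (G := C_AbelianMonoid)). intros p Hp.
    destruct (hsum p ltac:(lia)) as [Hd0 [Hd1 Hd2]].
    rewrite Hv0 in *. rewrite Hv1 in *. rewrite Hv2 in *.
    rewrite Nat.add_1_r in *. fold (z (S p)) in *.
    assert (E := hurwitz_lerch_triplication (z p) (- k) (v p) (Hzle p) (Hdef p ltac:(lia))).
    rewrite <- Hz3 in E. specialize (E Hd0 Hd1 Hd2).
    replace (- - k) with k in E by ring.
    unfold h. rewrite !Hexp, E, <- Hv3, Hz3.
    replace (Ci * 3 ^ S p) with (3 * (Ci * 3 ^ p)) by (cbn [Cpow]; ring).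
    rewrite Cpower_scale by lra.
    replace (Cexp (4 * Ci * m * 3 ^ p)) with (z p ^ 2).
    2:{ replace (4 * Ci * m * 3 ^ p) with (2 * Ci * m * 3 ^ p + 2 * Ci * m * 3 ^ p) by ring.
        rewrite Cexp_plus, Hexp. ring. }
    match goal with |- @eq _ ?x ?y => change (@eq C x y) end. ring.
  - rewrite telescoping_sum. f_equal. f_equal.
    assert (Eh0 : h 0%nat = Cpower Ci k * Cexp (2 * Ci * m) *
      hurwitz_lerch (- Cexp (2 * Ci * m)) (- k) (1 - 1 / 2 * Ci * L)).
    { unfold h, z, v. simpl Cpow. rewrite !Cmult_1_r.
      replace (1 - 1 / 2 * Ci * / 1 * L) with (1 - 1 / 2 * Ci * L) by (field; auto).
      reflexivity. }
    rewrite Eh0. unfold h, z, v. ring.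
Qed.
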